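(* Let $k\ge2$ and $n\ge1$. As maps on $k$-Dyck paths of size $n$, $$\widehat{RSK}\circ\delta=\partial^{-1}\circ\widehat{RSK},$$ where $\delta$ is rowmotion, $\partial$ is promotion, and $\widehat{RSK}$ is the inverse of the map $\widehat{RSK}^{-1}$ defined via maximal $k$-Dyck tilings in the context.
   Context: A $k$-Dyck path of size $n$ is a lattice path from $(0,0)$ to $(kn,n)$ with steps $U=(0,1)$, $R=(1,0)$, weakly above $y=x/k$, identified with its word of length $N=(k+1)n$. Promotion: the toggle $t_i$ ($1\le i\le N-1$) exchanges the $i$-th and $(i+1)$-st letters if the result is a $k$-Dyck path and otherwise fixes the path; $\partial=t_{N-1}\cdots t_2t_1$ ($t_1$ applied first). Rowmotion: consider the poset of unit boxes above the lowest path $(UR^k)^n$ and below the top path $U^nR^{kn}$, where a box is larger the further up and/or to the left it is (covers: the box immediately above, the box immediately to the left). A path $p$ corresponds to the order filter $F(p)$ of boxes above $p$; $\delta(p)$ is the path whose filter is the complement of the order ideal generated by the minimal elements of $F(p)$. Perfect matching $S(P)$ of a $k$-Dyck path: processing the up steps from the last to the first, the block of an up step at position $u$ consists of $u$ and the $k$ smallest positions $>u$ of right steps not yet used. It consists of $n$ blocks of $k+1$ integers. $k$-Dyck tilings: a $k$-Dyck tile is a ribbon of unit boxes whose centres, read from bottom left to top right, form a $k$-Dyck path (possibly of size $0$, a single box). A $k$-Dyck tiling above $P$ is a tiling by $k$-Dyck tiles of the region above $P$ and below $U^nR^{kn}$. It is cover-inclusive if every tile translated by $(1,-1)$ lies below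 $P$ or is contained in another tile (so sizes weakly decrease from bottom to top). It is maximal if its tiles have the largest size: there is no other cover-inclusive tiling of the same region such that every tile of the given one is contained in a tile of the other. The map $\widehat{RSK}^{-1}:P\mapsto Q$: let $D$ be the maximal cover-inclusive $k$-Dyck tiling above $P$. Order its tiles $d_1,\dots,d_m$ from bottom to top so that, with $\lambda_0=P$, the tile $d_p$ lies just above $\lambda_{p-1}$ and $\lambda_p$ is the lowest path above $\lambda_{p-1}$ and $d_p$. If the south-most edge of $d_p$ is the $i_p$-th step of $\lambda_{p-1}$ and its rightmost edge is the $j_p$-th step, exchange the integers $i_p$ and $j_p$ in the blocks of $S(P)$, successively for $p=1,\dots,m$. This gives a collection $\widehat S(P)$ of $n$ sets in which $1,\dots,n$ belong to distinct blocks. Let $S_i$ be the block containing $i$ ($1\le i\le n$) and $S_i'=S_i\setminus\{i\}$. Put $$\kappa_i=\#\Big\{j\in\bigcup_{1\le l\le n-i}S'_l:\ j<\min S'_{n+1-i}\Big\},\qquad y_i=(n-i)k-\kappa_i\qquad(1\le i\le n),$$ and $y_1^{\max}=y_1$, $y_i^{\max}=\min\{y_{i-1}^{\max},y_i\}$ for $2\le i\le n$. Then $Q$ is the $k$-Dyck path such that the region above $Q$ and below the top path is the Young diagram with rows, from the top, of lengths $y_1^{\max},\dots,y_n^{\max}$. *)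

(* Defs.v *)
From HB Require Import structures.
From mathcomp Require Import all_boot.
From mathcomp Require Import zify.

Set Implicit Arguments.
Unset Strict Implicit.
Unset Printing Implicit Defensive.

(* A step is a boolean: [true] is the up step U = (0,1), [false] is the right
   step R = (1,0).  Steps and positions in a word are numbered from 1. *)

Definition letter (w : bitseq) (i : nat) : bool := nth false w i.-1.

Definition vertex (w : bitseq) (i : nat) : nat * nat :=
  (count negb (take i w), count id (take i w)).

Definition is_kdyck (k n : nat) (w : bitseq) : bool :=
  (vertex w (size w) == (k * n, n)) &&
  all (fun i => (vertex w i).1 <= k * (vertex w i).2) (iota 0 (size w).+1).

Record kdyck (k n : nat) : Type := KDyck {
  steps :> (k.+1 * n).-tuple bool;
  _ : is_kdyck k n steps
}.

HB.instance Definition _ k n := [isSub for @steps k n].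
HB.instance Definition _ k n := [Finite of kdyck k n by <:].

Definition transp (a b m : nat) : nat :=
  if m == a then b else if m == b then a else m.

Definition swap_steps (N i : nat) (w : N.-tuple bool) : N.-tuple bool :=
  [tuple letter w (transp i i.+1 j.+1) | j < N].

Definition toggle (k n i : nat) (p : kdyck k n) : kdyck k n :=
  insubd p (swap_steps i p).

(* [foldl] applies the toggle t_1 first and t_(N-1) last. *)
Definition promotion (k n : nat) (p : kdyck k n) : kdyck k n :=
  foldl (fun q i => toggle i q) p (iota 1 (k.+1 * n).-1).

Lemma transpK a b : involutive (transp a b).
Proof. by move=> m; rewrite /transp; repeat case: eqP => //; lia. Qed.

Lemma swap_stepsK N i : 0 < i < N -> involutive (@swap_steps N i).
Proof.
move=> iN w; apply: eq_from_tnth => j; rewrite tnth_mktuple /letter.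
have jN := ltn_ord j.
set m := (transp i i.+1 j.+1).-1.
have mN : m < N by rewrite /m /transp; repeat case: eqP => ?; lia.
have m0 : transp i i.+1 j.+1 = m.+1.
  by rewrite /m /transp; repeat case: eqP => ?; lia.
have -> : m = nat_of_ord (Ordinal mN) by [].
rewrite -tnth_nth tnth_mktuple /letter /= -m0 transpK /=.
by rewrite (tnth_nth false).
Qed.

Lemma toggleK k n i : 0 < i < k.+1 * n -> involutive (@toggle k n i).
Proof.
move=> iN p; apply: val_inj; rewrite /toggle !val_insubd.
case h: (is_kdyck k n (swap_steps i p)); last by rewrite h.
by rewrite swap_stepsK // (valP p).
Qed.

Lemma promotion_inj k n : injective (@promotion k n).
Proof.
rewrite /promotion.
have: all (fun i => 0 < i < k.+1 * n) (iota 1 (k.+1 * n).-1).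
  by apply/allP => i; rewrite mem_iota; lia.
elim: (iota _ _) => [_ p q //|i s IH /= /andP[hi /IH hs]] p q /hs.
exact: (can_inj (toggleK hi)).
Qed.

Definition promotion_inv (k n : nat) : kdyck k n -> kdyck k n :=
  invF (@promotion_inj k n).

(* The box (x, y) is the unit square [x, x+1] x [y, y+1]. *)
Definition box : Type := (nat * nat)%type.

(* Abscissas of the successive up steps.  The boxes of the horizontal strip of
   height y which are above the path are those to the left of the up step
   starting at height y. *)
Definition rows (w : bitseq) : seq nat :=
  [seq (vertex w i).1 | i <- iota 0 (size w) & nth false w i].

Definition row_len (w : bitseq) (y : nat) : nat := nth 0 (rows w) y.

(* As [row_len w y] is 0 when y is at least the number of up steps, only boxes
   below the top path are selected. *)
Definition above (w : bitseq) (b : box) : bool := b.1 < row_len w b.2.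

Definition lowest_word (k n : nat) : bitseq :=
  flatten (nseq n (true :: nseq k false)).

Definition boxes (k n : nat) : seq box :=
  [seq b <- [seq (x, y) | x <- iota 0 (k * n), y <- iota 0 n]
  | above (lowest_word k n) b].

Definition box_le (b c : box) : bool := (c.1 <= b.1) && (b.2 <= c.2).

Definition order_filter (k n : nat) (p : kdyck k n) : seq box :=
  [seq b <- boxes k n | above p b].

Definition minimals (s : seq box) : seq box :=
  [seq b <- s | all (fun c => box_le c b ==> (c == b)) s].

Definition ideal (k n : nat) (s : seq box) : seq box :=
  [seq b <- boxes k n | has (box_le b) s].

Definition is_rowmotion (k n : nat) (p q : kdyck k n) : bool :=
  all (fun b => (b \in order_filter q)
                == (b \notin ideal k n (minimals (order_filter p))))
      (boxes k n).

(* The default value is never used, see [rowmotionP]. *)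
Definition rowmotion (k n : nat) (p : kdyck k n) : kdyck k n :=
  odflt p [pick q | is_rowmotion p q].

Lemma rows_true w : rows (true :: w) = 0 :: rows w.
Proof.
rewrite /rows /= (iotaDl 1 0) filter_map -map_comp; congr (_ :: _).
Qed.

Lemma rows_false w : rows (false :: w) = map S (rows w).
Proof.
by rewrite /rows /= (iotaDl 1 0) filter_map -!map_comp.
Qed.

Lemma rows_nseq m w : rows (nseq m false ++ w) = map (addn m) (rows w).
Proof.
elim: m => [|m IH] /=; first by rewrite map_id.
by rewrite rows_false IH -map_comp.
Qed.

Lemma size_rows w : size (rows w) = count id w.
Proof.
elim: w => [//|[] w IH]; first by rewrite rows_true /= IH.
by rewrite rows_false size_map IH.
Qed.

Lemma row_len_lowest k n y :
  row_len (lowest_word k n) y = if y < n then k * y else 0.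
Proof.
rewrite /row_len.
have low m : lowest_word k m.+1 = true :: nseq k false ++ lowest_word k m by [].
have sz m : size (rows (lowest_word k m)) = m.
  rewrite size_rows /lowest_word; elim: m => [//|m IH].
  by rewrite /= count_cat count_nseq IH; lia.
case: ltnP => yn; last by rewrite nth_default ?sz.
elim: n y yn => [//|n IH] [|y] yn; rewrite low rows_true ?muln0 //=.
rewrite rows_nseq /= (nth_map 0) ?sz //.
by rewrite IH // mulnS.
Qed.

Lemma mem_boxes k n b : (b \in boxes k n) = (b.2 < n) && (b.1 < k * b.2).
Proof.
case: b => x y; rewrite mem_filter /above row_len_lowest /=.
case: (ltnP y n) => yn /=; last by [].
case: (ltnP x (k * y)) => //= xk.
apply/allpairsP; exists (x, y); split => //=; rewrite mem_iota add0n //=.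
by apply: leq_trans xk _; rewrite leq_mul2l (ltnW yn) orbT.
Qed.

Fixpoint word_of (e r : nat) (rs : seq nat) : bitseq :=
  if rs is a :: rs' then nseq (a - r) false ++ true :: word_of e a rs'
  else nseq (e - r) false.

Lemma rows_word_of e r rs :
  path leq r rs -> map (addn r) (rows (word_of e r rs)) = rs.
Proof.
elim: rs r => [|a rs IH] r /=.
  by move=> _; rewrite -[nseq _ _]cats0 rows_nseq.
case/andP=> ra /IH h; rewrite rows_nseq rows_true /= addn0 subnKC //.
congr (_ :: _); rewrite -[RHS]h -map_comp; apply: eq_map => x /=; lia.
Qed.

Lemma count_word_of e r rs : path leq r rs -> last r rs <= e ->
  count id (word_of e r rs) = size rs /\
  r + count negb (word_of e r rs) = e.
Proof.
elim: rs r => [|a rs IH] r /=.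
  by rewrite !count_nseq => _ re; split; lia.
case/andP=> ra h1 h2; have [h3 h4] := IH a h1 h2.
rewrite !count_cat !count_nseq /= h3; split; lia.
Qed.

Lemma word_of_dyck k u e r rs i : path leq r rs -> r <= k * u ->
  (forall j, j < size rs -> nth 0 rs j <= k * (u + j)) ->
  e <= k * (u + size rs) ->
  r + count negb (take i (word_of e r rs)) <=
    k * (u + count id (take i (word_of e r rs))).
Proof.
have tk m l : take m (nseq l false) = nseq (minn m l) false.
  by elim: m l => [|m IH] [|l] //=; rewrite IH minnSS.
elim: rs r u i => [|a rs IH] r u i /=.
  by move=> _ hr _ he; rewrite tk !count_nseq; nia.
case/andP=> ra h hr hrs he.
have ha : a <= k * u by move: (hrs 0 isT); rewrite addn0.
rewrite take_cat size_nseq; case: (ltnP i (a - r)) => hi.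
  by rewrite tk !count_nseq; nia.
rewrite !count_cat !count_nseq.
case: (i - (a - r)) => [|i'] /=; first by nia.
have := IH a u.+1 i' h; have -> : k * u.+1 = k * u + k by lia.
have h1 : a <= k * u.+1 by nia.
have h2 j : j < size rs -> nth 0 rs j <= k * (u.+1 + j).
  by move=> hj; rewrite addSnnS; apply: hrs.
have h3 : e <= k * (u.+1 + size rs) by rewrite addSnnS.
have := IH a u.+1 i' h h1 h2 h3.
by rewrite /= mul1n mul0n !add0n add1n addnS addSn; lia.
Qed.

Lemma kdyck_of_rows k n (rs : seq nat) :
  size rs = n -> sorted leq rs -> (forall y, y < n -> nth 0 rs y <= k * y) ->
  {q : kdyck k n | rows q = rs}.
Proof.
move=> szr sr hr.
have pr : path leq 0 rs by case: (rs) sr.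
have lr : last 0 rs <= k * n.
  rewrite (last_nth 0) szr; case: (n) hr => [//|m] hr.
  by apply: leq_trans (hr m (ltnSn m)) _; rewrite leq_mul2l leqnSn orbT.
have [cU cR] := count_word_of pr lr.
have sz : size (word_of (k * n) 0 rs) == k.+1 * n.
  by rewrite -(count_predC id) cU szr -[count _ _]/(count negb _); lia.
suff hd : is_kdyck k n (Tuple sz).
  exists (KDyck hd); rewrite /= -[RHS](rows_word_of (k * n) pr).
  by rewrite (@eq_map _ _ (addn 0) id) ?map_id.
rewrite /is_kdyck /vertex take_size cU szr -[count _ _]add0n cR eqxx andTb.
apply/allP => i _; rewrite [_.1]/= [_.2]/=.
have := @word_of_dyck k 0 (k * n) 0 rs i pr; rewrite muln0 !add0n szr.
by apply.
Qed.

Lemma rowmotionP k n (p : kdyck k n) : is_rowmotion p (rowmotion p).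
Proof.
rewrite /rowmotion; case: pickP => [q //|none].
set I := ideal k n (minimals (order_filter p)) in none *.
pose r y := find (fun x => (x, y) \in I) (iota 0 (k * y)).
have rle y : r y <= k * y by rewrite -[leqRHS](size_iota 0) find_size.
have I_le b c : b \in boxes k n -> box_le b c -> c \in I -> b \in I.
  rewrite ![_ \in I]mem_filter => bb bc; rewrite bb andbT.
  move=> /andP[/hasP[m mm cm] _].
  apply/hasP; exists m => //; move: bc cm; rewrite /box_le; lia.
have rP b : b \in boxes k n -> (b \notin I) = (b.1 < r b.2).
  case: b => x y /= bb; have := bb; rewrite mem_boxes /= => /andP[yn xk].
  case: ltnP => h.
    have := before_find 0 h; rewrite nth_iota // => hx.
    by apply: negbT.
  apply: negbF; case: (ltnP (r y) (k * y)) => hr; last by lia.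
  have : has (fun x => (x, y) \in I) (iota 0 (k * y)).
    by rewrite has_find size_iota.
  move/(nth_find 0); rewrite -/(r y) nth_iota // add0n => hI.
  by apply: I_le hI => //; rewrite /box_le /= h leqnn.
have r_mono y : y.+1 < n -> r y <= r y.+1.
  move=> yn; case: leqP => // h.
  have h1 : r y.+1 < k * y by apply: leq_trans h (rle y).
  have b1 : (r y.+1, y) \in boxes k n by rewrite mem_boxes /= h1 andbT; lia.
  have b2 : (r y.+1, y.+1) \in boxes k n by rewrite mem_boxes /= yn /=; nia.
  have := rP _ b1; have := rP _ b2; rewrite /= h ltnn => /negbFE i2 i1.
  by move: i1; rewrite (I_le _ _ b1 _ i2) // /box_le /= leqnn leqnSn.
have [] := @kdyck_of_rows k n (mkseq r n); rewrite ?size_mkseq //.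
- apply/(sortedP 0) => i; rewrite size_mkseq => hi.
  by rewrite !nth_mkseq ?r_mono //; lia.
- by move=> y yn; rewrite nth_mkseq.
move=> q hq; move: (none q); rewrite /is_rowmotion => /negP[].
apply/allP => b bb; rewrite [_ \in order_filter _]mem_filter bb andbT rP //.
move: bb; rewrite mem_boxes => /andP[bn _].
by rewrite /above /row_len hq nth_mkseq.
Qed.

(* A tile is given by its first (bottom left) box together with the word of
   the path formed by the centres of its boxes. *)
Definition tile : Type := (box * bitseq)%type.

Definition tile_boxes (t : tile) : seq box :=
  [seq (t.1.1 + (vertex t.2 i).1, t.1.2 + (vertex t.2 i).2)
  | i <- iota 0 (size t.2).+1].

Definition first_box (t : tile) : box := t.1.

Definition last_box (t : tile) : box := last t.1 (tile_boxes t).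

Definition is_kdyck_tile (k : nat) (t : tile) : Prop :=
  exists m, is_kdyck k m t.2.

Definition tile_sub (t u : tile) : Prop :=
  {subset tile_boxes t <= tile_boxes u}.

Definition is_tiling (k n : nat) (p : kdyck k n) (D : seq tile) : Prop :=
  [/\ forall t, t \in D -> is_kdyck_tile k t,
      uniq (flatten (map tile_boxes D))
    & forall b, (b \in flatten (map tile_boxes D)) = above p b].

(* Translation by (1, -1).  The predecessor is not truncated on boxes above a
   k-Dyck path, as such a path starts with U and has no box above it in the
   strip of height 0. *)
Definition shift_box (b : box) : box := (b.1.+1, b.2.-1).

Definition cover_inclusive (k n : nat) (p : kdyck k n) (D : seq tile) : Prop :=
  forall t, t \in D ->
    (forall b, b \in tile_boxes t -> ~~ above p (shift_box b)) \/
    (exists u, [/\ u \in D, u != t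
       & forall b, b \in tile_boxes t -> shift_box b \in tile_boxes u]).

Definition is_ci_tiling (k n : nat) (p : kdyck k n) (D : seq tile) : Prop :=
  is_tiling p D /\ cover_inclusive p D.

Definition is_max_tiling (k n : nat) (p : kdyck k n) (D : seq tile) : Prop :=
  is_ci_tiling p D /\
  forall E, is_ci_tiling p E ->
    (forall t, t \in D -> exists2 u, u \in E & tile_sub t u) -> E =i D.

(* [us]: up steps still to be processed; [free]: unused right steps. *)
Fixpoint match_blocks (k : nat) (us free : seq nat) : seq (seq nat) :=
  if us is u :: us' then
    let b := take k [seq r <- free | u < r] in
    (u :: b) :: match_blocks k us' [seq r <- free | r \notin b]
  else [::].

Definition matching (k : nat) (w : bitseq) : seq (seq nat) :=
  let pos := iota 1 (size w) in
  match_blocks k (rev [seq i <- pos | letter w i])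
                 [seq i <- pos | ~~ letter w i].

(* The i-th step of w is the bottom edge, resp. the right edge, of b. *)
Definition is_bottom_edge (w : bitseq) (i : nat) (b : box) : bool :=
  [&& 0 < i <= size w, ~~ letter w i & vertex w i.-1 == b].

Definition is_right_edge (w : bitseq) (i : nat) (b : box) : bool :=
  [&& 0 < i <= size w, letter w i & vertex w i.-1 == (b.1.+1, b.2)].

(* q is obtained from p by adding the tile t just above p: the region above p
   is the disjoint union of t and of the region above q. *)
Definition add_tile (k n : nat) (p q : kdyck k n) (t : tile) : Prop :=
  (forall b, b \in tile_boxes t -> above p b) /\
  (forall b, above q b = above p b && (b \notin tile_boxes t)).

(* [exchange p D B C]: the tiles of D can be added in this order above p, and
   the successive exchanges of integers turn the collection B into C.  The
   south-most edge of a tile is the bottom edge of its first box, and its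
   rightmost edge is the right edge of its last box, because a k-Dyck path
   starts with U and ends with R. *)
Inductive exchange (k n : nat) :
    kdyck k n -> seq tile -> seq (seq nat) -> seq (seq nat) -> Prop :=
| exchange_nil p B : exchange p [::] B B
| exchange_cons p q t D i j B C :
    add_tile p q t ->
    is_bottom_edge p i (first_box t) ->
    is_right_edge p j (last_box t) ->
    exchange q D (map (map (transp i j)) B) C ->
    exchange p (t :: D) B C.

Definition block_of (B : seq (seq nat)) (i : nat) : seq nat :=
  nth [::] B (find (fun b => i \in b) B).

Definition block_of' (B : seq (seq nat)) (i : nat) : seq nat :=
  [seq j <- block_of B i | j != i].

Definition seq_min (s : seq nat) : nat := foldr minn (head 0 s) s.

Definition kappa (n : nat) (B : seq (seq nat)) (i : nat) : nat :=
  count (fun j => j < seq_min (block_of' B (n.+1 - i)))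
    (undup (flatten [seq block_of' B l | l <- iota 1 (n - i)])).

(* The subtraction is not truncated: each block contributes k integers besides
   its index, so that [kappa] counts at most (n - i) * k of them. *)
Definition ylen (k n : nat) (B : seq (seq nat)) (i : nat) : nat :=
  (n - i) * k - kappa n B i.

Fixpoint running_min (y : nat -> nat) (i : nat) : nat :=
  match i with
  | 0 => 0 (* indices start at 1 *)
  | 1 => y 1
  | i'.+1 => minn (running_min y i') (y i)
  end.

Definition ymax (k n : nat) (B : seq (seq nat)) : nat -> nat :=
  running_min (ylen k n B).

(* The list D also records the order in which its tiles are added. *)
Definition RSKinv_graph (k n : nat) (P Q : kdyck k n) : Prop :=
  exists D C,
    [/\ is_max_tiling P D,
        exchange P D (matching k P) C
      & forall i, 0 < i <= n -> row_len Q (n - i) = ymax k n C i].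

(* Main.v *)
Require Import Defs.
From mathcomp Require Import all_boot.
From mathcomp Require Import zify.

Set Implicit Arguments.
Unset Strict Implicit.
Unset Printing Implicit Defensive.

(** Let [N = (k+1) n], and let the block of an up step [u] end at the position
    [block_end u].

    The tiles of the maximal tiling above [P] can be added so that a single up
    step moves at a time.  All up steps wait in a queue, ordered by decreasing
    end of their blocks.  For [y = 0, ..., n-1] the position [y+1] is served: if
    a waiting up step is already there, it stays; otherwise the head of the
    queue slides left to it.  What lies between two successive stops of the
    sliding step is a union of whole blocks of waiting steps, that is, a k-Dyck
    word, so that each jump adds one k-Dyck tile ([slide_step],
    [slides_exist]).  These tiles form a cover-inclusive tiling ([slides_ci]).
    A stop inside the stretch available to a layer belongs to a block which does
    not fit into this stretch ([slide_cut_layer]), whereas a k-Dyck tile covers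
    whole blocks; so every cover-inclusive tiling refines this one
    ([ci_refines]), which is therefore the unique maximal one.
    Two tiles containing comparable boxes occur in the same order in every
    admissible sequence, and the exchanges of other pairs of tiles commute; so
    the resulting collection of blocks does not depend on the sequence
    ([exchange_all_perm]).

    For the block served at time [m], consider the position of one of its right
    steps plus the number of letters beyond it which belong to blocks still
    waiting at time [m].  No later jump changes this sum ([arr_cnt]), so it can
    be read off from [P]; at the end it is [N - ylen] ([ylenE]).  It is at most
    the largest end of a block waiting at time [m], with equality when the
    served step is the head of the queue.  The running minimum thus turns into
    the rule ([RSKinv_graphP]): row [y] of [Q] has length [N - last_end P y],
    where [last_end P y] is the largest end of a block waiting at time [y].

    Promotion sends [U A R B], with [A] a k-Dyck word, to [A U B R]
    ([promotion_word]): it rotates the blocks by one position.  Consequently the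
    queue of [Y] at time [y+1] is the queue of [promotion Y] at time [y] with
    its head removed and all positions shifted by one ([queue_shift]).  Compared
    row by row, this is the recursion which describes rowmotion by row lengths
    ([local_rule], [is_rowmotion_rows]): the rowmotion of
    [RSKinv (promotion Y)] is [RSKinv Y].

    Iterating the shift of the queue, row [y] of the image under [RSKinv] of the
    path obtained by applying [y] inverse promotions to [P] determines the
    [y+1]st largest block end of [P] ([last_end_iter]).  As [RSKinv] intertwines
    inverse promotion and rowmotion, [RSKinv P] determines all block ends of
    [P], and these determine [P] ([perm_ends_eq]).  So [RSKinv] is injective,
    hence bijective on the finite set of k-Dyck paths. *)

(** * Paths and the ends of their blocks *)

Definition is_up (w : bitseq) (i : nat) : bool := (0 < i) && letter w i.

Ltac clear_lia := repeat match goal with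
  | H : is_true (letter _ _) |- _ => clear H
  | H : is_true (~~ letter _ _) |- _ => clear H
  | H : is_true (is_up _ _) |- _ => clear H
  | H : is_true (~~ is_up _ _) |- _ => clear H
  | H : is_true (_ \in _) |- _ => clear H
  | H : is_true (_ \notin _) |- _ => clear H
  | H : is_true (is_kdyck _ _ _) |- _ => clear H
  end; lia.

Definition ups (w : bitseq) (i : nat) : nat := count id (take i w).

Lemma ups0 w : ups w 0 = 0.
Proof. by rewrite /ups take0. Qed.

Lemma upsS w i : ups w i.+1 = ups w i + letter w i.+1.
Proof.
rewrite /ups /letter /=; case: (ltnP i (size w)) => iw.
  by rewrite (take_nth false) // -cats1 count_cat /= addn0.
by rewrite !take_oversize ?nth_default ?addn0 // ltnW.
Qed.

Lemma ups_mono w i j : i <= j -> ups w i <= ups w j.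
Proof.
move=> ij; rewrite -(subnKC ij); elim: (j - i) => [|d IH]; first by rewrite addn0.
by rewrite addnS upsS; lia.
Qed.

Lemma ups_lip w i j : i <= j -> ups w j <= ups w i + (j - i).
Proof.
move=> ij; rewrite -{1}(subnKC ij); elim: (j - i) => [|d IH]; first by rewrite !addn0.
by rewrite addnS upsS; lia.
Qed.

Lemma ups_le w i : ups w i <= i.
Proof. by have := @ups_lip w 0 i isT; rewrite ups0; lia. Qed.

Lemma vertexE w i : i <= size w -> vertex w i = (i - ups w i, ups w i).
Proof.
move=> iw; rewrite /vertex -/(ups w i); congr (_, _).
have := count_predC id (take i w); rewrite size_takel // -/(ups w i).
by rewrite -[count (predC id) _]/(count negb (take i w)); lia.
Qed.

Lemma letter_default w i : size w < i -> letter w i = false.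
Proof. by case: i => // i h; rewrite /letter nth_default. Qed.

Lemma ups_count w i : ups w i = count (letter w) (iota 1 i).
Proof.
elim: i => [|i IH]; first by rewrite ups0.
by rewrite upsS IH -[i.+1 in RHS]addn1 iotaD count_cat add1n /= addn0.
Qed.

Lemma ups_inj w w' : size w = size w' ->
  (forall i, i <= size w -> ups w i = ups w' i) -> w = w'.
Proof.
move=> sz h; apply: (@eq_from_nth _ false) => // i iw.
have := h i.+1 iw; rewrite !upsS (h i (ltnW iw)) /letter /=.
by move/addnI; do 2!case: nth.
Qed.

Lemma letter_le_size w i : letter w i -> i <= size w.
Proof. by apply: contraTT; rewrite -ltnNge => /letter_default ->. Qed.

Definition upsteps (w : bitseq) : seq nat := [seq i <- iota 1 (size w) | letter w i].

Lemma mem_upsteps w i : (i \in upsteps w) = is_up w i.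
Proof.
rewrite mem_filter mem_iota /is_up; case: (boolP (letter w i)) => [/letter_le_size|]; lia.
Qed.

Lemma uniq_upsteps w : uniq (upsteps w).
Proof. by rewrite filter_uniq ?iota_uniq. Qed.

Lemma count_upsteps w v : count (fun u => u <= v) (upsteps w) = ups w v.
Proof.
wlog vN : v / v <= size w.
  move=> H; case: (leqP v (size w)) => [/H //|Nv].
  rewrite (_ : ups w v = ups w (size w)); last by rewrite /ups !take_oversize // ltnW.
  rewrite -H //; apply: eq_in_count => u; rewrite mem_upsteps => /andP[_ /letter_le_size].
  by lia.
rewrite /upsteps ups_count count_filter -{1}(subnKC vN) iotaD count_cat.
rewrite [X in _ + X](@eq_in_count _ _ pred0) ?count_pred0 ?addn0 => [|i].
  by apply: eq_in_count => i; rewrite mem_iota /=; lia.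
by rewrite mem_iota /=; lia.
Qed.

(** A path stays above the line when [x <= k y] at each vertex; as [i = x + y]
    after [i] steps, this is the linear inequality [i <= (k+1) y] in the
    single counting function [ups]. *)
Definition dyck (k n : nat) (w : bitseq) : Prop :=
  [/\ size w = k.+1 * n, ups w (size w) = n
    & forall i, i <= size w -> i <= k.+1 * ups w i].

Lemma dyckP k n w : reflect (dyck k n w) (is_kdyck k n w).
Proof.
rewrite /is_kdyck vertexE //; apply: (iffP andP).
  case=> /eqP [h1 h2] /allP h3; have := ups_le w (size w); split => //; first by lia.
  move=> i iw; have := h3 i; rewrite mem_iota vertexE //= => /(_ iw).
  by have := ups_le w i; lia.
case=> h1 h2 h3; split; first by apply/eqP; congr (_, _); lia.
apply/allP => i; rewrite mem_iota => /andP[_ iw]; rewrite vertexE //=.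
by have := h3 i iw; lia.
Qed.

Lemma steps_dyck k n (p : kdyck k n) : dyck k n p.
Proof. exact/dyckP/(valP p). Qed.

Lemma is_up_ups w i : is_up w i -> ups w i = (ups w i.-1).+1.
Proof. by case: i => // i /andP[_ h]; rewrite upsS h addn1. Qed.

Lemma right_ups w i : 0 < i -> ~~ is_up w i -> ups w i = ups w i.-1.
Proof. by case: i => // i _; rewrite /is_up /= => /negbTE h; rewrite upsS h addn0. Qed.

(** The factor from the up step [u] to the position [e] contains at least [k]
    right steps for each of its up steps. *)
Definition ends_at k w u e :=
  (u <= e) && (k.+1 * ups w e + u.-1 <= e + k.+1 * ups w u.-1).

(** The right steps of the block of [u] are the first ones not claimed by
    later up steps, so the block closes as soon as the factor which starts at
    [u] is balanced. *)
Definition block_end (k : nat) (w : bitseq) (u : nat) : nat :=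
  find (ends_at k w u) (iota 0 (size w).+1).

Lemma find_iota (P : pred nat) m e : e < m -> P e ->
  [/\ P (find P (iota 0 m)), find P (iota 0 m) <= e
    & forall i, i < find P (iota 0 m) -> ~~ P i].
Proof.
move=> em Pe.
have hs : has P (iota 0 m) by apply/hasP; exists e; rewrite ?mem_iota.
have lt : find P (iota 0 m) < m by rewrite -[ltnRHS](size_iota 0) -has_find.
have nf i : i < find P (iota 0 m) -> ~~ P i.
  by move=> h; have := before_find 0 h; rewrite nth_iota ?(ltn_trans h) // => ->.
have Pf : P (find P (iota 0 m)) by have := nth_find 0 hs; rewrite nth_iota.
split=> //; rewrite leqNgt; apply/negP => /nf; by rewrite Pe.
Qed.

Section Dyck.

Variables (k n : nat) (w : bitseq).
Hypothesis k0 : 0 < k.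
Hypothesis wD : dyck k n w.

Local Notation N := (size w).
Local Notation h := (fun i => k.+1 * ups w i).
Local Notation block_end := (block_end k w).

Lemma block_endP u : is_up w u ->
  [/\ u < block_end u, block_end u <= N, block_end u + h u.-1 = u.-1 + h (block_end u)
    & forall i, u <= i -> i < block_end u -> i + h u.-1 < u.-1 + h i].
Proof.
move=> Uu; case: wD => hN hn hD; have uN : u <= N by apply: letter_le_size; case/andP: Uu.
have u0 : 0 < u by case/andP: Uu.
have PN : ends_at k w u N.
  rewrite /ends_at uN /= hn -hN; have := hD u.-1; lia.
have [] := find_iota (ltnSn N) PN; rewrite -/(block_end u) => /andP[le1 le2] eN nf.
have {}nf i : u <= i -> i < block_end u -> i + h u.-1 < u.-1 + h i.
  by move=> ui /nf; rewrite /ends_at ui /=; lia.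
have us := is_up_ups Uu.
have ltu : u < block_end u.
  rewrite ltn_neqAle le1 andbT; apply/eqP => E; move: le2; rewrite -E us; nia.
split=> //; case E: (block_end u) => [|e]; first by lia.
have := nf e; rewrite E ltnSn; move: le2; rewrite E upsS => le2.
case: (letter w e.+1) le2 => /= le2; first by rewrite mulnDr; nia.
by rewrite addn0 in le2 *; lia.
Qed.

Lemma block_end_unique u e : is_up w u -> u <= e -> e <= N ->
  u.-1 + h e <= e + h u.-1 ->
  (forall i, u <= i -> i < e -> i + h u.-1 < u.-1 + h i) -> block_end u = e.
Proof.
move=> Uu ue eN he hi; have [f1 f2 f3 f4] := block_endP Uu.
case: (ltngtP (block_end u) e) => // c; first by have := hi _ (ltnW f1) c; lia.
by have := f4 _ ue c; lia.
Qed.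

(** If the span of [v] went beyond that of [u], both the factor from [u] to
    just before [v] and the factor from [v] to the end of [u] would be
    unbalanced, but they make up the balanced span of [u]. *)
Lemma block_end_nest u v : is_up w u -> is_up w v -> u <= v -> v <= block_end u ->
  block_end v <= block_end u.
Proof.
move=> Uu Uv uv ve; have [f1 f2 f3 f4] := block_endP Uu; have [g1 g2 g3 g4] := block_endP Uv.
case: leqP => // c; have a := g4 _ ve c; case: (ltngtP u v) uv => // [uv _|E _].
  have u0 : 0 < u by case/andP: Uu.
  by have := f4 v.-1; lia.
by subst v; lia.
Qed.

Lemma block_end_inj u v : is_up w u -> is_up w v -> block_end u = block_end v -> u = v.
Proof.
wlog uv : u v / u <= v.
  by move=> H Uu Uv E; case: (leqP u v) => [/H->//|/ltnW/H-> //].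
move=> Uu Uv E; have [f1 f2 f3 f4] := block_endP Uu; have [g1 g2 g3 g4] := block_endP Uv.
case: (ltngtP u v) uv => // uv _; have u0 : 0 < u by case/andP: Uu.
by rewrite -E in g3; have := f4 v.-1; lia.
Qed.

(** The up step found follows the last vertex before [r] at which the path is
    no higher above the line than at the vertex [r]: between them the path is
    strictly higher, so that the span cannot close before [r]. *)
Lemma cover_ex a r : a < r -> r <= N -> ~~ is_up w r ->
  r + h a <= a + h r -> exists2 u, is_up w u & a < u <= r /\ r <= block_end u.
Proof.
move=> ar rN Rr hr.
pose P u := (u < r) && (r + h u <= u + h r).
have Pa : P a by rewrite /P ar; lia.
have bP u : P u -> u <= r by case/andP=> /ltnW.
case: (ex_maxnP (ex_intro _ a Pa) bP) => u /andP[ur hu] um.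
have au := um a Pa.
have r0 : 0 < r by lia.
have st i : u < i -> i < r -> i + h r < r + h i.
  move=> ui ir; case: ltnP => // c; have := um i; rewrite /P ir; lia.
have Uu : is_up w u.+1.
  case: (ltngtP u.+1 r) ur => // [ur' _|E _].
    case: (boolP (is_up w u.+1)) => // /(right_ups (ltn0Sn _)) /= E.
    by have := st u.+1 (ltnSn u) ur'; rewrite E; lia.
  by have := right_ups r0 Rr; rewrite -E /= => E'; move: hu; rewrite -E E'; lia.
exists u.+1 => //; split; first by lia.
have [f1 f2 f3 f4] := block_endP Uu; case: leqP => // c.
have := st (block_end u.+1); move: f3 => /=; lia.
Qed.

(** The innermost span which contains the position [i]: the default [0] of
    [last] is taken only when no span does. *)
Definition block_start (i : nat) : nat :=
  last 0 [seq u <- iota 1 i | is_up w u && (i <= block_end u)].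

Lemma block_start_max i u : is_up w u -> u <= i -> i <= block_end u -> u <= block_start i.
Proof.
move=> Uu ui iu; rewrite /block_start.
set s := filter _ _.
have us : u \in s by rewrite mem_filter Uu iu mem_iota; case/andP: Uu; lia.
have ss : sorted leq s.
  by apply: sorted_filter => //; [exact: leq_trans|exact: iota_sorted].
case: s us ss => // a s us /= pa.
have /allP ha : all (leq^~ (last a s)) (a :: s).
  elim: s a pa {us} => [|b s IH] a /=; first by rewrite leqnn.
  case/andP=> ab /IH /= /andP[h1 h2]; rewrite h1 h2 !andbT.
  exact: leq_trans ab h1.
exact: ha.
Qed.

Lemma block_start_mem i : 0 < i <= N -> [/\ is_up w (block_start i), block_start i <= i & i <= block_end (block_start i)].
Proof.
case/andP=> i0 iN; suff [u Uu [ui iu]] : exists2 u, is_up w u & u <= i /\ i <= block_end u.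
  have := block_start_max Uu ui iu; rewrite /block_start.
  set s := filter _ _; have s_mem x : x \in s -> [/\ is_up w x, x <= i & i <= block_end x].
    by rewrite mem_filter mem_iota => /andP[/andP[-> ->]] => h; split => //; lia.
  case: s s_mem => [_ /=|a s sm _]; first by case/andP: Uu; lia.
  by apply: sm; rewrite /= mem_last.
case: (boolP (is_up w i)) => Ui; first by exists i => //; have [] := block_endP Ui; lia.
have [|u Uu [/andP[_ ui] iu]] := cover_ex i0 iN Ui; last by exists u.
by rewrite ups0; case: wD => _ _ /(_ i iN); lia.
Qed.

Lemma block_start_up i : is_up w i -> block_start i = i.
Proof.
move=> Ui; have i0 : 0 < i by case/andP: Ui.
have iN : i <= N by apply: letter_le_size; case/andP: Ui.
have [f1 f2 _ _] := block_endP Ui; have := block_start_max Ui (leqnn i) (ltnW f1).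
by have [] := @block_start_mem i; lia.
Qed.

(** Blocks do not cross: a block with one element inside a span lies entirely
    inside it. *)
Lemma block_start_nest i u : 0 < i <= N -> is_up w u -> u <= i -> i <= block_end u ->
  u <= block_start i /\ block_end (block_start i) <= block_end u.
Proof.
move=> iN Uu ui iu; have uo := block_start_max Uu ui iu; have [oU oi io] := block_start_mem iN.
by split=> //; apply: block_end_nest => //; lia.
Qed.

Lemma block_start_right i : 0 < i <= N -> ~~ is_up w i -> block_start i < i.
Proof.
move=> iN Ri; have [oU oi io] := block_start_mem iN.
by rewrite ltn_neqAle oi andbT; apply: contraNneq Ri => <-.
Qed.

Lemma size_upsteps : size (upsteps w) = n.
Proof. by rewrite size_filter -ups_count; case: wD. Qed.

End Dyck.

(** * The queue of waiting up steps *)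

Section Queue.

Variables (k : nat) (w : bitseq).

(** The order of the queue. *)
Definition later (u v : nat) : bool := block_end k w v < block_end k w u.

(** The up step which takes the position [y+1]. *)
Definition chosen (s : seq nat) (y : nat) : nat :=
  if y.+1 \in s then y.+1 else head 0 s.

(** The up steps which still wait at time [y], when the positions up to [y]
    have been served. *)
Fixpoint queue (y : nat) : seq nat :=
  if y is y'.+1 then rem (chosen (queue y') y') (queue y')
  else sort (fun u v => block_end k w v <= block_end k w u) (upsteps w).

Definition served (y : nat) : nat := chosen (queue y) y.

Lemma queueS y : queue y.+1 = rem (served y) (queue y).
Proof. by []. Qed.

Lemma later_trans : transitive later.
Proof. by move=> b a c; rewrite /later; lia. Qed.

Variable n : nat.
Hypothesis k0 : 0 < k.
Hypothesis wD : dyck k n w.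
Local Notation block_end := (block_end k w).
Local Notation block_start := (block_start k w).

Lemma perm_queue0 : perm_eq (queue 0) (upsteps w).
Proof. by apply/permPl; apply: perm_sort. Qed.

Lemma uniq_queue y : uniq (queue y).
Proof.
elim: y => [|y IH]; last by rewrite queueS rem_uniq.
by rewrite (perm_uniq perm_queue0) uniq_upsteps.
Qed.

Lemma mem_queueS y u : (u \in queue y.+1) = (u != served y) && (u \in queue y).
Proof. by rewrite queueS mem_rem_uniq ?uniq_queue. Qed.

Lemma queue_sub y y' : y <= y' -> {subset queue y' <= queue y}.
Proof.
move=> h; rewrite -(subnKC h); elim: (y' - y) => [|d IH]; first by rewrite addn0.
by move=> u; rewrite addnS mem_queueS => /andP[_ /IH].
Qed.

Lemma mem_queue0 u : (u \in queue 0) = is_up w u.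
Proof. by rewrite (perm_mem perm_queue0) mem_upsteps. Qed.

Lemma queue_up y u : u \in queue y -> is_up w u.
Proof. by move/(queue_sub (leq0n y)); rewrite mem_queue0. Qed.

Lemma queue_sorted y : sorted later (queue y).
Proof.
elim: y => [|y IH]; last first.
  exact: (subseq_sorted later_trans (rem_subseq _ _) IH).
have : sorted (fun u v => block_end v <= block_end u) (queue 0).
  by apply: sort_sorted => u v; exact: leq_total.
move: (uniq_queue 0) (@mem_queue0); move: (queue 0) => s us ms.
have {ms} : {subset s <= is_up w} by move=> u; rewrite ms.
case: s us => //= a s; elim: s a => //= b s IH a /andP[nin us] ms /andP[ab ps].
apply/andP; split; last first.
  by apply: IH => // u us'; apply: ms; rewrite inE us' orbT.
rewrite /later ltn_neqAle ab andbT; apply: contraNneq nin => E.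
by rewrite (block_end_inj k0 wD _ _ E) ?mem_head //; apply: ms; rewrite !inE eqxx ?orbT.
Qed.

Lemma size_queue y : y <= n -> size (queue y) = n - y.
Proof.
elim: y => [|y IH] yn; first by rewrite (perm_size perm_queue0) (size_upsteps wD) subn0.
have sz := IH (ltnW yn); rewrite queueS size_rem ?sz; first by lia.
rewrite /served /chosen; case: ifP => // _.
by case: (queue y) sz => [/=|a s _]; [lia|exact: mem_head].
Qed.

Lemma served_mem y : y < n -> served y \in queue y.
Proof.
move=> yn; have sz := size_queue (ltnW yn); rewrite /served /chosen; case: ifP => // _.
by case: (queue y) sz => [/=|a s _]; [lia|exact: mem_head].
Qed.

(** A waiting up step at the position [y+1] is chosen, so the positions served
    so far hold no waiting step. *)
Lemma queue_gt y u : u \in queue y -> y < u.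
Proof.
elim: y => [|y IH]; first by move/queue_up/andP => [].
rewrite mem_queueS => /andP[us uq]; have := IH uq.
rewrite leq_eqVlt => /predU1P[E|//]; move: us.
by rewrite /served /chosen E uq eqxx.
Qed.

Lemma head_queue y u : u \in queue y -> block_end u <= block_end (head 0 (queue y)).
Proof.
have := queue_sorted y; case: (queue y) => // a s /=.
rewrite (path_sortedE later_trans) inE => /andP[/allP h _] /predU1P[->//|/h].
by rewrite /later => /ltnW.
Qed.

Lemma served_head y : served y != y.+1 -> served y = head 0 (queue y).
Proof. by rewrite /served /chosen; case: ifP; rewrite ?eqxx. Qed.

(** An up step beyond [y] which no longer waits has left the queue as its
    head, at a time when [v] was waiting behind it. *)
Lemma greedy y u v : is_up w u -> y < u -> u \notin queue y -> v \in queue y ->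
  block_end v < block_end u.
Proof.
move=> Uu; elim: y => [|y IH] yu; first by rewrite (mem_queue0 u) Uu.
rewrite !mem_queueS negb_and negbK => h /andP[vs vq].
case: (boolP (u \in queue y)) h => [uq|nuq _]; last by apply: IH => //; lia.
rewrite orbF => /eqP us.
rewrite ltn_neqAle; apply/andP; split.
  by apply: contraNneq vs => /(block_end_inj k0 wD (queue_up vq) Uu) ->; rewrite us.
rewrite us served_head; first exact: head_queue.
by rewrite -us; lia.
Qed.

Lemma servedP y u : is_up w u -> u \notin queue y ->
  exists2 y', y' < y & u = served y' /\ u \in queue y'.
Proof.
move=> Uu; elim: y => [|y IH]; first by rewrite mem_queue0 Uu.
rewrite mem_queueS negb_and negbK; case: (boolP (u \in queue y)) => [uq|nuq _].
  by rewrite orbF => /eqP us; exists y.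
by have [y' yy h] := IH nuq; exists y' => //; lia.
Qed.

Lemma served_up y : y < n -> is_up w (served y).
Proof. by move/served_mem/queue_up. Qed.

Lemma served_gt y : y < n -> y < served y.
Proof. by move/served_mem/queue_gt. Qed.

Lemma served_notin y : served y \notin queue y.+1.
Proof. by rewrite mem_queueS eqxx. Qed.

Lemma served_inj y y' : y < n -> y' < n -> served y = served y' -> y = y'.
Proof.
wlog h : y y' / y <= y'.
  by move=> H yn yn' E; case: (leqP y y') => [/H->|/ltnW/H->].
move=> yn yn' E; case: (ltngtP y y') h => // h _.
by have := served_notin y; rewrite E (queue_sub h (served_mem yn')).
Qed.

(** A block inside the span of a waiting step [u] ends no later than [u], so
    by [greedy] it cannot have been served before [u]. *)
Lemma block_start_queue y u i : u \in queue y -> u <= i -> i <= block_end u -> block_start i \in queue y.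
Proof.
move=> uq ui iu; have Uu := queue_up uq; have [f1 f2 _ _] := block_endP k0 wD Uu.
have yu := queue_gt uq; have iN : 0 < i <= size w by lia.
have [uo ou] := block_start_nest k0 wD iN Uu ui iu; have [oU _ _] := block_start_mem k0 wD iN.
by apply: contraLR uq => nq; apply/negP => /(greedy oU _ nq); lia.
Qed.

(** Both sides count the up steps which stand at most at [v] or have been
    served; exactly [y] of them have been served, those up to [y] among them. *)
Lemma count_queue y v : y <= n -> y <= v ->
  count (fun u => u <= v) (queue y) + y =
  ups w v + count (fun u => (v < u) && (u \notin queue y)) (upsteps w).
Proof.
move=> yn yv.
have c1 := count_predC (fun u => u <= v) (queue y); rewrite size_queue // in c1.
have c2 := count_predC (fun u => u <= v) (upsteps w).
rewrite count_upsteps (size_upsteps wD) in c2.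
have c3 : count (predC (fun u => u <= v)) (queue y) =
          count (fun u => (v < u) && (u \in queue y)) (upsteps w).
  rewrite -!size_filter; apply/perm_size/uniq_perm; try (apply: filter_uniq; (exact: uniq_queue || exact: uniq_upsteps)).
  move=> u.
  rewrite mem_filter [RHS]mem_filter mem_upsteps /= -ltnNge; case: (boolP (u \in queue y)) => [uq|].
    by rewrite (queue_up uq) !andbT.
  by rewrite !andbF.
have := count_predUI (fun u => (v < u) && (u \in queue y))
  (fun u => (v < u) && (u \notin queue y)) (upsteps w).
rewrite [X in _ + X = _](@eq_count _ _ pred0) ?count_pred0; last first.
  by move=> u /=; case: (_ \in _); rewrite ?andbF.
rewrite [X in X + 0 = _](@eq_count _ _ (predC (fun u => u <= v))); last first.
  by move=> u /=; case: (_ \in _); rewrite ?andbF ?andbT ?orbF -?ltnNge.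
by lia.
Qed.

End Queue.

Arguments queue : simpl never.

(** * Boxes, tiles, and the jump of an up step over a closed factor *)

(** The number of steps before the lower right corner of a box, on any path
    through this corner.  With the ordinate it locates the box, and
    translation by [(1, -1)] preserves it. *)
Definition corner (b : box) : nat := (b.1 + b.2).+1.

(** The box lies above the path when the path passes its antidiagonal at or
    below the lower right corner of the box. *)
Lemma above_ups w b : above w b = (b.2 < count id w) && (ups w (corner b) <= b.2).
Proof.
case: b => x y; rewrite /above /corner /row_len /ups /=.
elim: w x y => [|[] w IH] x y /=; first by rewrite nth_nil.
  rewrite rows_true; case: y => [|y] //=.
  rewrite addnS IH /=; lia.
rewrite rows_false; case: (ltnP y (count id w)) => yc; last first.
  by rewrite nth_default // size_map size_rows.
rewrite (nth_map 0) ?size_rows //; case: x => [|x].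
  rewrite !add0n ltnS leq0n; apply/esym.
  by have := count_size id (take y w); rewrite size_take; case: ltnP; lia.
by rewrite ltnS IH yc.
Qed.

Lemma kdyck_count k n (p : kdyck k n) : count id p = n.
Proof. by have [_ + _] := steps_dyck p; rewrite /ups take_size. Qed.

Lemma above_kdyck k n (p : kdyck k n) b :
  above p b = (b.2 < n) && (ups p (corner b) <= b.2).
Proof. by rewrite above_ups kdyck_count. Qed.

Lemma corner_vertex w i : i <= size w -> corner (vertex w i) = i.+1.
Proof. by move=> h; rewrite vertexE // /corner /= subnK // ups_le. Qed.

Definition first_corner (t : tile) : nat := corner t.1.

(** The ordinate of the box of [t] with corner index [v]. *)
Definition row_at (t : tile) (v : nat) : nat := t.1.2 + ups t.2 (v - first_corner t).

Lemma mem_tile t b : (b \in tile_boxes t) =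
  (first_corner t <= corner b <= first_corner t + size t.2) && (b.2 == row_at t (corner b)).
Proof.
case: t => [[x y] s]; case: b => x' y'.
rewrite /row_at /first_corner /corner [size _]/= [(_, _).1]/= [(_, _).2]/=.
apply/mapP/andP => [[i]|[hv /eqP hy]].
  rewrite mem_iota add0n [(_, _).2]/= => hi; rewrite vertexE; last by lia.
  have := ups_le s i => ui [-> ->] /=.
  split; first by lia.
  by rewrite (_ : (_ - _) = i) //; lia.
have {}hv : x + y <= x' + y' <= x + y + size s by move: hv => /=; lia.
have {}hy : y' = y + ups s ((x' + y').+1 - (x + y).+1) by [].
exists ((x' + y').+1 - (x + y).+1); first by rewrite mem_iota /=; lia.
have := ups_le s ((x' + y').+1 - (x + y).+1).
rewrite vertexE [(_, _).2]/=; last by lia.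
by move: hy; set u := ups _ _ => hy hu /=; congr pair; lia.
Qed.

Definition box_at (v m : nat) : box := (v.-1 - m, m).

Lemma corner_box_at v m : m < v -> corner (box_at v m) = v.
Proof. by rewrite /corner /=; lia. Qed.

Lemma box_atE b : b = box_at (corner b) b.2.
Proof. by case: b => x y; rewrite /box_at /corner /=; congr pair; lia. Qed.

Lemma row_at_lt t v : first_corner t <= v <= first_corner t + size t.2 -> row_at t v < v.
Proof.
case: t => [[x y] s]; rewrite /row_at /first_corner /corner /= => h.
by have := ups_le s (v - (x + y).+1); lia.
Qed.

Lemma tile_box t v : first_corner t <= v <= first_corner t + size t.2 ->
  box_at v (row_at t v) \in tile_boxes t.
Proof.
move=> h; have lt := row_at_lt h.
by rewrite mem_tile corner_box_at // h eqxx.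
Qed.

(** A tile has one box on each antidiagonal that it meets, so the set of its
    boxes gives back its first box and the vertices of its word. *)
Lemma tile_ext t u : tile_sub t u -> tile_sub u t -> t = u.
Proof.
move=> tu ut.
have sub t1 t2 : tile_sub t1 t2 -> first_corner t2 <= first_corner t1 /\
    first_corner t1 + size t1.2 <= first_corner t2 + size t2.2 /\
    forall v, first_corner t1 <= v <= first_corner t1 + size t1.2 -> row_at t2 v = row_at t1 v.
  move=> s.
  have s' v : first_corner t1 <= v <= first_corner t1 + size t1.2 ->
      (first_corner t2 <= v <= first_corner t2 + size t2.2) && (row_at t1 v == row_at t2 v).
    by move=> h; have := s _ (tile_box h); rewrite mem_tile corner_box_at ?row_at_lt.
  split; first by have := s' (first_corner t1); lia.
  split; first by have := s' (first_corner t1 + size t1.2); lia.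
  by move=> v /s' /andP[_ /eqP].
have [a1 [a2 a3]] := sub _ _ tu; have [b1 [b2 _]] := sub _ _ ut.
have e1 : first_corner t = first_corner u by lia.
have e2 : size t.2 = size u.2 by lia.
have e3 : t.1.2 = u.1.2.
  by have := a3 (first_corner t); rewrite /row_at -e1 subnn !ups0 !addn0 => ->; lia.
have e4 : t.1 = u.1.
  by rewrite (box_atE t.1) (box_atE u.1) -/(first_corner t) -/(first_corner u) e1 e3.
case: t u e1 e2 e3 e4 a3 {tu ut a1 a2 b1 b2} => [bt st] [bu su] /= _ e2 _ -> a3.
congr pair; apply: ups_inj => // i hi.
have := a3 (first_corner (bu, st) + i); rewrite /row_at /first_corner /=.
by rewrite (_ : corner bu + i - corner bu = i); lia.
Qed.

Definition factor (w : bitseq) (a b : nat) : bitseq := take (b - a) (drop a w).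

Lemma size_factor w a b : b <= size w -> size (factor w a b) = b - a.
Proof. by move=> h; rewrite size_takel // size_drop; lia. Qed.

Lemma ups_factor w a b i : a + i <= b -> ups w (a + i) = ups w a + ups (factor w a b) i.
Proof.
move=> h; rewrite /factor {3}/ups take_takel; last by lia.
by rewrite -{1}(cat_take_drop a w) /ups takeD -count_cat -takeD cat_take_drop takeD.
Qed.

Lemma letter_factor w a b i : 0 < i -> a + i <= b ->
  letter (factor w a b) i = letter w (a + i).
Proof.
case: i => // i _ h; rewrite /letter /= nth_take; last by lia.
by rewrite nth_drop addnS.
Qed.

Lemma last_box_tile t : last_box t = box_at (first_corner t + size t.2) (row_at t (first_corner t + size t.2)).
Proof.
rewrite /last_box /tile_boxes -addn1 iotaD cats1 map_rcons last_rcons add0n vertexE //.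
rewrite /row_at (_ : _ + _ - _ = size t.2); last by lia.
rewrite /box_at /first_corner /corner; have := ups_le t.2 (size t.2).
by set u := ups _ _ => h /=; congr pair; lia.
Qed.

(** Moving the up step at [x] to the right step at [r], over a k-Dyck factor,
    raises the path by one unit exactly at the vertices from [r] to [x-1], and
    the boxes thus crossed form a ribbon with the shape of the factor. *)
Lemma add_tile_slide k n (p : kdyck k n) r x m :
  0 < r -> r < x -> x <= k.+1 * n -> ~~ letter p r -> letter p x ->
  is_kdyck k m (factor p r x.-1) ->
  exists (q : kdyck k n) (t : tile),
  [/\ forall i, 0 < i -> letter q i = (i == r) || (i != x) && letter p i,
      add_tile p q t,
      is_bottom_edge p r (first_box t) /\ is_right_edge p x (last_box t)
    & [/\ first_corner t = r, t.2 = factor p r x.-1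
        & forall v, r <= v < x -> row_at t v = ups p v]].
Proof.
move=> r0 rx xN Lr Lx fD; pose t := (vertex p r.-1, factor p r x.-1).
have [sp hn hD] := steps_dyck p; rewrite sp in hn hD.
pose L i := (i == r) || (i != x) && letter p i.
pose w := mkseq (fun j => L j.+1) (k.+1 * n).
have sw : size w = k.+1 * n by rewrite size_mkseq.
have Lw i : 0 < i -> letter w i = L i.
  case: i => // i _; rewrite /letter /=; case: (ltnP i (k.+1 * n)) => h.
    by rewrite nth_mkseq.
  rewrite nth_default ?sw // /L letter_default ?sp //.
  by apply/esym/negbTE; rewrite negb_or negb_and; lia.
have uw i : ups w i + (x <= i) = ups p i + (r <= i).
  elim: i => [|i IH]; first by rewrite !ups0; lia.
  rewrite !upsS Lw // /L; case: (eqVneq i.+1 r) => [E|]; last first.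
    case: (eqVneq i.+1 x) => [E|] /=; [rewrite E Lx|]; lia.
  by move: Lr; rewrite -E; lia.
have wD : is_kdyck k n w.
  apply/dyckP; split; [by []| |].
    by rewrite sw; have := uw (k.+1 * n); rewrite hn; lia.
  move=> i; rewrite sw => iN; have := hD i iN.
  by have := uw i; nia.
have swE : size w == k.+1 * n by rewrite sw.
have qD : is_kdyck k n (Tuple swE) by [].
have t1 : t.1 = (r.-1 - ups p r.-1, ups p r.-1) by rewrite -vertexE // sp; lia.
have tv : first_corner t = r by rewrite /first_corner t1 /corner /=; have := ups_le p r.-1; lia.
have ur : ups p r = ups p r.-1.
  by rewrite -[in LHS](prednK r0) upsS prednK // (negbTE Lr) addn0.
have sz : size t.2 = x.-1 - r by rewrite size_factor ?sp; lia.
have th v : r <= v < x -> row_at t v = ups p v.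
  move=> h; rewrite /row_at tv t1 [(_, _).2]/=.
  by rewrite -ur -ups_factor; last lia; congr ups; lia.
exists (KDyck qD), t; split=> //; last split.
- split=> b; first rewrite mem_tile above_kdyck tv sz.
    case/andP=> hb /eqP; rewrite th; last by lia.
    move=> ->; rewrite leqnn andbT.
    have : ups p x <= n by rewrite -[leqRHS]hn; apply: ups_mono.
    have : ups p x = (ups p x.-1).+1.
      by rewrite -[in LHS](prednK (n := x)) ?upsS ?prednK ?Lx ?addn1 //; lia.
    by have := @ups_mono p (corner b) x.-1; lia.
  rewrite !above_kdyck mem_tile tv sz /=.
  have := uw (corner b); case hb: (r <= corner b <= r + (x.-1 - r)) => /= hu.
    by rewrite th; lia.
  by lia.
- by rewrite /is_bottom_edge sp Lr eqxx; lia.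
- rewrite /is_right_edge sp Lx last_box_tile tv sz (_ : r + _ = x.-1); last by lia.
  have := @row_at_lt t x.-1; rewrite th ?tv ?sz; try lia.
  move=> lt; apply/and3P; split; [by lia|by []|].
  rewrite vertexE ?sp /box_at /=; last by lia.
  by apply/eqP; congr pair; lia.
Qed.

Arguments tile_boxes : simpl never.
Arguments vertex : simpl never.

(** * One jump of a served up step *)

Section Closed.

Variables (k n : nat) (w : bitseq).
Hypothesis k0 : 0 < k.
Hypothesis wD : dyck k n w.
Local Notation N := (size w).
Local Notation h := (fun i => k.+1 * ups w i).
Local Notation block_end := (block_end k w).
Local Notation block_start := (block_start k w).

(** Each right step is balanced within its own span, which gives the
    inequality for all prefixes; each up step closes within the factor, which
    gives equality at the end. *)
Lemma closed_factor a b : a <= b -> b <= N ->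
  (forall i, a < i <= b -> a < block_start i /\ block_end (block_start i) <= b) ->
  exists m, is_kdyck k m (factor w a b).
Proof.
move=> ab bN cl.
have pre i : a <= i -> i <= b -> i + h a <= a + h i.
  elim/ltn_ind: i => i IH ai ib; case: (ltngtP a i) ai => // [ai _|-> _]; last by lia.
  have i0 : 0 < i by lia.
  case: (boolP (is_up w i)) => Ui.
    by have := is_up_ups Ui; have := IH i.-1; lia.
  have iN : 0 < i <= N by lia.
  have [] := cl i; first by lia.
  have [] := block_start_mem k0 wD iN; have := block_start_right k0 wD iN Ui.
  move: (block_start i) => u ui Uu _ iu au ub; have [f1 f2 f3 f4] := block_endP k0 wD Uu.
  have := IH u.-1; have := f4 i; case: (ltngtP i (block_end u)) iu => // [|E]; first by lia.
  by rewrite -E in f3; lia.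
have suf d i : i + d = b -> a <= i -> h b + i <= h i + b.
  elim/ltn_ind: d i => -[|d] IH i E ai; first by rewrite -E addn0.
  case: (boolP (is_up w i.+1)) => Ui; last first.
    by have := right_ups (ltn0Sn i) Ui; have := IH d (ltnSn d) i.+1; rewrite /=; lia.
  have [f1 f2 f3 f4] := block_endP k0 wD Ui; have := cl i.+1; rewrite (block_start_up k0 wD Ui) => -[]; first by lia.
  move=> _ fb; have := IH (b - block_end i.+1) _ (block_end i.+1); rewrite /= in f3; lia.
have tot := suf (b - a) a (subnKC ab) (leqnn a); have := pre b ab (leqnn b) => tot'.
have um := ups_mono w ab.
exists (ups w b - ups w a); apply/dyckP; rewrite /dyck size_factor //.
have uf i : i <= b - a -> ups (factor w a b) i = ups w (a + i) - ups w a.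
  by move=> hi; rewrite (@ups_factor w a b) ?addKn; lia.
split; first by nia.
  by rewrite uf // subnKC.
by move=> i hi; rewrite uf //; have := pre (a + i); have := @ups_mono w a (a + i); nia.
Qed.

(** A right step of a k-Dyck factor is covered by an up step of the factor
    ([cover_ex]), and an up step of it has enough right steps after it inside
    the factor. *)
Lemma factor_closed a b m : a <= b -> b <= N -> is_kdyck k m (factor w a b) ->
  forall i, a < i <= b -> a < block_start i /\ block_end (block_start i) <= b.
Proof.
move=> ab bN /dyckP []; rewrite size_factor // => sz tot pre i ib.
have uf j : j <= b - a -> ups w (a + j) = ups w a + ups (factor w a b) j.
  by move=> hj; apply: ups_factor; lia.
have pre' j : a <= j <= b -> j + h a <= a + h j.
  by move=> hj; have := pre (j - a); have := uf (j - a); rewrite subnKC; nia.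
have tot' : b + h a = a + h b by have := uf (b - a) (leqnn _); rewrite tot subnKC //; nia.
have fb u : is_up w u -> a < u <= b -> block_end u <= b.
  move=> Uu ub; have [f1 f2 f3 f4] := block_endP k0 wD Uu.
  by case: leqP => // c; have := f4 b; have := pre' u.-1; lia.
case: (boolP (is_up w i)) => Ui; first by rewrite (block_start_up k0 wD Ui); have := fb _ Ui ib; lia.
have iN : 0 < i <= N by lia.
have [oU oi io] := block_start_mem k0 wD iN.
have [ai iN' hi] : [/\ a < i, i <= N & i + h a <= a + h i] by split; try (apply: pre'); lia.
have [u Uu [/andP[au ui] iu]] := cover_ex k0 wD ai iN' Ui hi.
have := block_start_max k0 Uu ui iu => uo; split; first by lia.
by apply: fb => //; lia.
Qed.

End Closed.

Lemma count_between a b m : a < b -> b <= m.+1 ->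
  count (fun j => a < j < b) (iota 1 m) = b.-1 - a.
Proof.
move=> ab bm.
have -> : m = a + (b.-1 - a) + (m - b.-1) by lia.
rewrite !iotaD !count_cat.
rewrite (@eq_in_count _ _ pred0 (iota 1 a)) ?count_pred0 => [|i]; last first.
  by rewrite mem_iota /=; lia.
rewrite (@eq_in_count _ _ predT (iota (1 + a) _)) ?count_predT => [|i]; last first.
  by rewrite mem_iota /=; lia.
rewrite (@eq_in_count _ _ pred0) ?count_pred0 => [|i]; last first.
  by rewrite mem_iota /=; lia.
by rewrite size_iota addn0.
Qed.

Lemma count_mem_iota (s : seq nat) y v : uniq s -> (forall u, u \in s -> y < u) ->
  y <= v -> count (fun i => i \in s) (iota y.+1 (v - y)) = count (fun u => u <= v) s.
Proof.
move=> us gt yv; rewrite -!size_filter; apply/perm_size/uniq_perm.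
- by rewrite filter_uniq ?iota_uniq.
- by rewrite filter_uniq.
move=> u; rewrite !mem_filter mem_iota; case: (boolP (u \in s)) => [/gt|]; lia.
Qed.

Section Slides.

Variables (k n : nat) (P : kdyck k n).
Hypothesis k0 : 0 < k.
Local Notation N := (k.+1 * n).
Local Notation block_end := (block_end k P).
Local Notation block_start := (block_start k P).
Local Notation queue := (queue k P).
Local Notation served := (served k P).
Let PD := steps_dyck P.

Let sP : size P = N.
Proof. by case: PD. Qed.

(** The tile added at time [y] when the served step jumps from [x] to [r].
    Both stops lie outside the waiting blocks, and between them only waiting
    blocks occur; the last field gives the ordinates of the boxes, which are
    those of the current path. *)
Record slide (t : tile) (y r x : nat) : Prop := Slide {
  slide_y : y < n;
  slide_r : y < r;
  slide_rx : r < x;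
  slide_x : x <= served y;
  slide_cutr : block_start r \notin queue y.+1;
  slide_cutx : block_start x \notin queue y.+1;
  slide_in : forall i, r < i < x -> block_start i \in queue y.+1;
  slide_vtx : first_corner t = r;
  slide_size : r + size t.2 = x.-1;
  slide_height : forall v, r <= v < x ->
    row_at t v = y + count (fun u => u <= v) (queue y.+1)
}.

(** The function [f] sends the position of a letter in [P] to its present
    position.  The field [arr_cnt] is the conserved sum for the blocks served
    before time [m]: the position of a right step of such a block plus the
    number of letters beyond it from blocks which were waiting when the block
    was served. *)
Record arrangement (m : nat) (f : nat -> nat) : Prop := Arrangement {
  arr_dom : forall i, 0 < i <= N -> 0 < f i <= N;
  arr_inj : forall i j, 0 < i <= N -> 0 < j <= N -> f i = f j -> i = j;
  arr_ord : forall i j, 0 < i -> i < j -> j <= N -> block_start i = block_start j ->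
    ~~ is_up P i -> f i < f j;
  arr_cnt : forall l i, l < m -> 0 < i <= N -> ~~ is_up P i -> block_start i = served l ->
    f i + count (fun j => (block_start j \in queue l) && (f i < f j)) (iota 1 N) =
    i + count (fun j => (block_start j \in queue l) && (i < j)) (iota 1 N)
}.

(** The step served at time [y] is on its way, at the position [x].  The up
    steps of the path are the [y] placed ones, the waiting ones and the moving
    one; the letters of the waiting blocks have not moved ([st_fix]). *)
Record state (p : kdyck k n) (y x : nat) (f : nat -> nat) : Prop := State {
  st_y : y < n;
  st_x : y < x <= served y;
  st_cut : block_start x \notin queue y.+1;
  st_letter : forall i, 0 < i ->
    letter p i = (i <= y) || (i \in queue y.+1) || (i == x);
  st_arr : arrangement y.+1 f;
  st_fix : forall i, 0 < i <= N -> block_start i \in queue y.+1 -> f i = i;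
  st_type : forall i, 0 < i <= N -> letter p (f i) = is_up P i;
  st_lab : forall l, l < y -> f (served l) = l.+1;
  st_cur : f (served y) = x
}.

Lemma served_range l : l < n -> 0 < served l <= N.
Proof.
move=> ln; have := served_up k0 PD ln; case/andP=> s0 /letter_le_size; rewrite sP; lia.
Qed.

Lemma block_start_served l : l < n -> block_start (served l) = served l.
Proof. by move=> ln; apply: (block_start_up k0 PD); apply: (served_up k0 PD). Qed.

(** The next stop [r] is the last position before [x] outside the waiting
    blocks; it exists because [y+1] is one.  Only the letters at [r] and [x]
    change places.  In the conserved sum of a block whose right step moves
    from [r] to [x], the increase [x - r] is compensated by the letters
    between [r] and [x] and by the moving up step, all from blocks that were
    waiting and no longer beyond it; other sums see no letter cross. *)
Lemma slide_step p y x f : state p y x f -> y.+1 < x ->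
  exists q t r, [/\ slide t y r x, is_kdyck_tile k t, add_tile p q t,
    is_bottom_edge p r (first_box t) /\ is_right_edge p x (last_box t)
    & state q y r (transp r x \o f)].
Proof.
move=> [yn xs cx Lp ar fx ty lab cur] yx.
have sN := served_range yn; have Us := served_up k0 PD yn.
pose cut i := (y < i < x) && (block_start i \notin queue y.+1).
have cy : cut y.+1.
  rewrite /cut ltnSn yx /=; apply/negP => /(queue_gt).
  by have [] := @block_start_mem k n P k0 PD y.+1; rewrite ?sP; clear_lia.
have cb i : cut i -> i <= x by rewrite /cut; clear_lia.
case: (ex_maxnP (ex_intro _ y.+1 cy) cb) => r /andP[/andP[yr rx] cr] rmax.
have btw i : r < i < x -> block_start i \in queue y.+1.
  move=> ir; case: (boolP (block_start i \in queue y.+1)) => // ci.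
  by have := rmax i; rewrite /cut ci andbT; clear_lia.
have qo i : i \in queue y.+1 -> block_start i = i by move/queue_up=> U; apply: (block_start_up k0 PD).
have Lr : ~~ letter p r.
  rewrite Lp; last by clear_lia.
  rewrite !negb_or -ltnNge yr ltn_eqF // andbT /=.
  by apply: contra cr => rq; rewrite qo.
have Lx : letter p x by rewrite Lp ?eqxx ?orbT; clear_lia.
have Lb i : r < i < x -> letter p i = letter P i.
  move=> ir; rewrite Lp; last by clear_lia.
  rewrite (_ : (i == x) = false); last by clear_lia.
  rewrite orbF leqNgt (_ : y < i) /=; last by clear_lia.
  have oq := btw i ir; apply/idP/idP => [/queue_up /andP[]//|Li].
  by rewrite -[i](block_start_up k0 PD) // /is_up Li andbT; clear_lia.
have [sp _ _] := steps_dyck p.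
have facE : factor p r x.-1 = factor P r x.-1.
  have s1 : size (factor p r x.-1) = x.-1 - r by rewrite size_factor ?sp; clear_lia.
  have s2 : size (factor P r x.-1) = x.-1 - r by rewrite size_factor ?sP; clear_lia.
  apply: ups_inj; rewrite s1 ?s2 // => i hi.
  rewrite !ups_count; apply: eq_in_count => j; rewrite mem_iota => hj.
  by rewrite !letter_factor ?Lb //; clear_lia.
have [m fD] : exists m, is_kdyck k m (factor P r x.-1).
  apply: (closed_factor k0 PD); rewrite ?sP; try clear_lia.
  move=> i ir; have ir' : r < i < x by clear_lia.
  have iN : 0 < i <= size P by rewrite sP; clear_lia.
  have oq := btw i ir'; have [oU oi io] := block_start_mem k0 PD iN.
  split.
    rewrite ltnNge; apply: contra cr => ro; apply: (block_start_queue k0 PD oq) => //; clear_lia.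
  suff : block_end (block_start i) < x by clear_lia.
  by rewrite ltnNge; apply: contra cx => ox; apply: (block_start_queue k0 PD oq) => //; clear_lia.
have r0 : 0 < r by clear_lia.
have xN : x <= N by clear_lia.
have [|q [t [Lq adq edges [tv tw th]]]] := add_tile_slide (m := m) r0 rx xN Lr Lx.
  by rewrite facE.
have st : size t.2 = x.-1 - r by rewrite tw size_factor // sp (leq_trans (leq_pred _)).
exists q, t, r.
have upp v : y <= v -> v < x -> ups p v = y + count (fun u => u <= v) (queue y.+1).
  move=> yv vx; rewrite ups_count -{1}(subnKC yv) iotaD count_cat.
  congr (_ + _).
    rewrite (@eq_in_count _ _ predT) ?count_predT ?size_iota // => i.
    rewrite mem_iota => /andP[i0 iy]; rewrite Lp //.
    by have -> : i <= y by move: iy; rewrite add1n.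
  have qy u : u \in queue y.+1 -> y < u by move/queue_gt/ltnW.
  rewrite add1n -(count_mem_iota (uniq_queue k P y.+1) qy yv).
  apply: eq_in_count => i; rewrite mem_iota addSn subnKC // => /andP[yi iv].
  rewrite Lp; last exact: leq_trans yi.
  by rewrite [i <= y]leqNgt yi /= (ltn_eqF (leq_trans iv vx)) orbF.
pose g := transp r x \o f.
have gE i : g i = if f i == r then x else if f i == x then r else f i by [].
have fs j : 0 < j <= N -> f j = x -> j = served y.
  by move=> jN fj; apply: (arr_inj ar) => //; rewrite cur.
have fb j : 0 < j <= N -> r < f j < x -> f j = j.
  move=> jN fj; apply: esym; apply: (arr_inj ar) => //; first exact: (arr_dom ar).
  by rewrite (fx (f j)) ?btw ?(arr_dom ar) //; exact: (arr_dom ar).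
have upx i : 0 < i <= N -> ~~ is_up P i -> f i != x.
  by move=> iN; apply: contraNneq => /(fs _ iN) ->.
split.
- split=> //; first by case/andP: xs.
    by rewrite st subnKC // -ltnS prednK // (leq_trans r0) // ltnW.
  move=> v /andP[rv vx]; rewrite th ?rv // upp //.
  by rewrite (leq_trans _ rv) // ltnW.
- by exists m; rewrite tw facE.
- exact: adq.
- by [].
have Lq' i : 0 < i <= N -> letter q (g i) = letter p (f i).
  move=> iN; have fi0 : 0 < f i by case/andP: (arr_dom ar iN).
  have x0 := ltn_trans r0 rx; rewrite gE.
  case: (eqVneq (f i) r) => [->|nr].
    by rewrite Lq // eqxx (gtn_eqF rx) (negbTE Lr).
  case: (eqVneq (f i) x) => [->|nx]; first by rewrite Lq // eqxx Lx.
  by rewrite Lq // nx (negbTE nr).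
split=> //.
- by clear_lia.
- move=> i i0; rewrite Lq // Lp //; case: (eqVneq i r) => [_|nr]; first by rewrite orbT.
  case: (eqVneq i x) => [->|_] /=; last by rewrite !orbF.
  rewrite orbF; apply/esym/negbTE; rewrite negb_or -ltnNge; apply/andP; split; first clear_lia.
  by apply: contra cx => xq; rewrite qo.
- split.
  + by move=> i iN; have := arr_dom ar iN; rewrite /= /transp; repeat case: eqP => ?; clear_lia.
  + by move=> i j iN jN /(can_inj (transpK r x)) /(arr_inj ar iN jN).
  + move=> i j i0 ij jN E Ri.
    have iN : 0 < i <= N by clear_lia.
    have jN' : 0 < j <= N by clear_lia.
    have lt := arr_ord ar i0 ij jN E Ri.
    have Rj : ~~ is_up P j.
      apply/negP => Uj; have [] := @block_start_mem k n P k0 PD i; first by rewrite sP.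
      by rewrite E (block_start_up k0 PD Uj); clear_lia.
    have := upx _ iN Ri; have := upx _ jN' Rj; rewrite -/g !gE.
    case: (boolP (block_start i \in queue y.+1)) => [oq|nq].
      rewrite (fx i iN oq) (fx j jN' _) -?E //.
      have -> : (i == r) = false by apply: contraNF cr => /eqP <-.
      have -> : (j == r) = false by apply: contraNF cr => /eqP <-; rewrite -E.
      by repeat case: eqP => ?; clear_lia.
    have nb : ~~ (r < f j < x).
      by apply: contra nq => fj; rewrite E -(fb j jN' fj) btw.
    by repeat case: eqP => ?; clear_lia.
  + move=> l i ly iN Ri oi.
    have fi := arr_cnt ar ly iN Ri oi; rewrite -{}fi -/g.
    have nq : block_start i \notin queue y.+1.
      rewrite oi; apply/negP => /(queue_sub ly).
      by apply/negP/served_notin.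
    have nb : ~~ (r < f i < x).
      by apply: contra nq => hfi; rewrite -(fb i iN hfi) btw.
    have nx := upx _ iN Ri.
    have oth : f i != r -> g i = f i by rewrite gE (negbTE nx) => /negbTE ->.
    case: (eqVneq (f i) r) => [fr|nr]; last first.
      rewrite oth //; congr (_ + _); apply: eq_in_count => j; rewrite mem_iota => hj.
      by congr andb; rewrite gE; repeat case: eqP => ?; clear_lia.
    have -> : g i = x by rewrite gE fr eqxx.
    (* The letters beyond [r] from the blocks waiting at time [l] are those
       beyond [x], those strictly between [r] and [x], and the moving step. *)
    have := count_predUI (fun j => (block_start j \in queue l) && (x < f j))
      (predU (fun j => r < j < x) (pred1 (served y))) (iota 1 N).
    have := count_predUI (fun j => r < j < x) (pred1 (served y)) (iota 1 N).
    rewrite count_between //; last by clear_lia.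
    rewrite (@count_uniq_mem _ (iota 1 N)) ?iota_uniq // mem_iota.
    rewrite (@eq_in_count _ (predI _ (pred1 _)) pred0) ?count_pred0; last first.
      by move=> j _ /=; apply/negbTE; case: (eqVneq j (served y)); clear_lia.
    rewrite (@eq_in_count _ (predI _ (predU _ _)) pred0) ?count_pred0; last first.
      move=> j; rewrite mem_iota /= => hj; apply/negbTE/negP => /andP[/andP[_ h1]].
      case/orP=> [h2|/eqP h2]; last by move: h1; rewrite h2 cur ltnn.
      by move: h1; rewrite fx ?btw //; clear_lia.
    rewrite (@eq_in_count _ (predU _ (predU _ _))
      (fun j => (block_start j \in queue l) && (r < f j))); last first.
      move=> j; rewrite mem_iota add1n ltnS /= => jN.
      case: (ltngtP (f j) x) => fjx.
      - rewrite andbF /=; case: (ltnP r (f j)) => rfj.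
          have jr : r < f j < x by clear_lia.
          have E := fb j jN jr; have jr' : r < j < x by rewrite -{1 2}E.
          by rewrite jr' andbT (queue_sub (ltnW ly) (btw j jr')).
        rewrite andbF; apply/negbTE; rewrite negb_or; apply/andP; split.
          by apply/negP => h; have := fx j jN (btw _ h); clear_lia.
        by apply: contraTneq fjx => ->; rewrite cur ltnn.
      - rewrite (_ : r < f j) ?andbT; last by clear_lia.
        case: (block_start j \in queue l) => //=; apply/negbTE; rewrite negb_or; apply/andP; split.
          by apply/negP => h; have := fx j jN (btw _ h); clear_lia.
        by apply: contraTneq fjx => ->; rewrite cur ltnn.
      rewrite (fs j jN fjx) block_start_served // eqxx !orbT cur rx andbT.
      by apply/esym/(queue_sub _ (served_mem k0 PD yn)).
    have -> : count (fun j => (block_start j \in queue l) && (x < g j)) (iota 1 N)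
            = count (fun j => (block_start j \in queue l) && (x < f j)) (iota 1 N).
      by apply: eq_in_count => j _; congr andb; rewrite gE; repeat case: eqP => ?; clear_lia.
    rewrite fr add1n ltnS sN !addn0 => -> E2; rewrite {}E2.
    by rewrite (addnC (count _ _)) addnA addn1 -subSn ?prednK ?subnKC //; clear_lia.
- move=> i iN oq; rewrite -/g gE fx //.
  have -> : (i == r) = false by apply: contraNF cr => /eqP <-.
  by have -> : (i == x) = false by apply: contraNF cx => /eqP <-.
- by move=> i iN; rewrite -/g Lq' // ty.
- by move=> l ly; rewrite -/g gE lab //; repeat case: eqP => ?; clear_lia.
- by rewrite -/g gE cur eqxx; case: eqP; clear_lia.
Qed.

End Slides.

(** * All jumps *)

Section Run.

Variables (k n : nat) (P : kdyck k n).
Hypothesis k0 : 0 < k.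
Local Notation N := (k.+1 * n).
Local Notation block_end := (block_end k P).
Local Notation block_start := (block_start k P).
Local Notation queue := (queue k P).
Local Notation served := (served k P).
Let PD := steps_dyck P.

Let sP : size P = N.
Proof. by case: PD. Qed.

(** All up steps occupy the positions [1, ..., n], and the step served at time
    [l] has the label [l+1]. *)
Record final (f : nat -> nat) : Prop := Final {
  final_arr : arrangement P n f;
  final_lab : forall l, l < n -> f (served l) = l.+1;
  final_right : forall i, 0 < i <= N -> ~~ is_up P i -> n < f i
}.

(** When the moving step has arrived at [y+1], the path is also the one on
    which the next served step has not yet moved. *)
Lemma state_turn p y f : state P p y y.+1 f -> y.+1 < n ->
  state P p y.+1 (served y.+1) f.
Proof.
move=> [yn xs cx Lp ar fx ty lab cur] yn1.
have sm := served_mem k0 PD yn1; have Us := served_up k0 PD yn1.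
have qS u : (u \in queue y.+1) = (u \in queue y.+2) || (u == served y.+1).
  by rewrite (mem_queueS k P y.+1); case: eqP => [->|]; rewrite ?sm ?orbT ?orbF.
split=> //.
- by rewrite leqnn andbT; apply: (served_gt k0 PD).
- by rewrite block_start_served // served_notin.
- move=> i i0; rewrite Lp // qS (leq_eqVlt i y.+1) ltnS.
  by move: (i <= y) (i \in queue y.+2) (i == y.+1) (i == served y.+1) => [] [] [] [].
- case: ar => dom inj ord cnt; split=> // l i; rewrite ltnS leq_eqVlt.
  case/predU1P => [->{l}|]; last exact: cnt.
  move=> iN Ri oi; rewrite fx //; last by rewrite oi.
  congr (_ + _); apply: eq_in_count => j; rewrite mem_iota => hj.
  by case: (boolP (block_start j \in _)) => // oj; rewrite fx //; clear_lia.
- by move=> i iN oi; apply: fx => //; apply: queue_sub oi.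
- move=> l; rewrite ltnS leq_eqVlt => /predU1P[->|/lab //]; exact: cur.
- by apply: fx; rewrite ?block_start_served ?served_range.
Qed.

Lemma state_final p y f : state P p y y.+1 f -> y.+1 = n ->
  final f /\ forall b, above p b = false.
Proof.
move=> [yn xs cx Lp ar fx ty lab cur] yn1.
have q0 : queue y.+1 = [::].
  by apply/size0nil; rewrite (size_queue k0 PD) yn1 ?subnn.
have Ln i : 0 < i -> letter p i = (i <= n).
  by move=> i0; rewrite Lp // q0 in_nil orbF -yn1 (leq_eqVlt i y.+1) ltnS orbC.
split.
  split.
  - by move: ar; rewrite yn1.
  - move=> l ln; have : l < y.+1 by rewrite yn1.
    by rewrite ltnS leq_eqVlt => /predU1P[->//|/lab].
  - move=> i iN; rewrite -ty // Ln ?ltnNge //.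
    by have := arr_dom ar iN; clear_lia.
move=> b; rewrite above_kdyck; apply/negbTE/negP => /andP[b2].
rewrite ups_count leqNgt => /negP[].
rewrite (@eq_in_count _ _ (fun i => i <= n)) => [|i]; last first.
  by rewrite mem_iota => hi; rewrite Ln //; clear_lia.
rewrite (@leq_trans (count (fun i => i <= n) (iota 1 b.2.+1))) //.
  rewrite (@eq_in_count _ _ predT) ?count_predT ?size_iota // => i.
  by rewrite mem_iota /=; clear_lia.
by rewrite /corner -addnS addnC iotaD count_cat leq_addr.
Qed.

Lemma transp_map r x (f : nat -> nat) (B : seq (seq nat)) :
  map (map (transp r x)) (map (map f) B) = map (map (transp r x \o f)) B.
Proof. by rewrite -map_comp; apply: eq_map => b /=; rewrite -map_comp. Qed.

Lemma uniq_tile t : uniq (tile_boxes t).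
Proof.
rewrite map_inj_in_uniq ?iota_uniq // => i j; rewrite !mem_iota => hi hj.
rewrite !vertexE; [|by clear_lia..] => -[]; have := ups_le t.2 i; have := ups_le t.2 j.
by move=> /=; clear_lia.
Qed.

Lemma add_tile_tiling p q t (D : seq tile) : is_kdyck_tile k t ->
  @add_tile k n p q t -> is_tiling q D -> is_tiling p (t :: D).
Proof.
move=> kt [ab aq] [kD uD mD].
have fl : flatten (map tile_boxes (t :: D)) =
  tile_boxes t ++ flatten (map tile_boxes D) by [].
split.
- by move=> u; rewrite inE => /predU1P[->|/kD].
- rewrite fl cat_uniq uniq_tile uD andbT; apply/hasPn => b.
  by rewrite mD aq => /andP[].
- move=> b; rewrite fl mem_cat mD aq.
  by case: (boolP (b \in _)) => /=; rewrite ?andbT ?andbF // => /ab ->.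
Qed.

(** Induction on the number of times left, then on the position of the moving
    step. *)
Lemma run p y x f B : state P p y x f ->
  exists D g, [/\ exchange p D (map (map f) B) (map (map g) B), final g,
    is_tiling p D & forall t, t \in D -> exists y' r' x', slide P t y' r' x'].
Proof.
have [m le] := ubnP ((n - y) * N.+1 + x).
elim: m => // m IH in p y x f le *; move=> st.
have [yn xs _ _ _ _ _ _ _] := st; have sN := served_range P k0 yn.
case: (ltngtP y.+1 x) => [yx|xy|E]; last 1 first.
- rewrite -E in st; case: (ltngtP y.+1 n) => [yn1|?|yn1]; try by clear_lia.
    have sN1 := served_range P k0 yn1.
    have [|D [g H]] := IH p y.+1 (served y.+1) f _ (state_turn st yn1).
      by move: le; rewrite -E (_ : n - y = (n - y.+1).+1) ?mulSn; clear_lia.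
    by exists D, g.
  have [fF ab] := state_final st yn1.
  exists [::], f; split=> //; [exact: exchange_nil|].
  by split=> // b; rewrite ab.
- have [q [t [r [sl kt ad [bot rig] st']]]] := slide_step k0 st yx.
  have [|D [g [ex fg ti sD]]] := IH q y r _ _ st'.
    by case: sl => _ _ rx *; clear_lia.
  exists (t :: D), g; split=> //.
  + by apply: (exchange_cons ad bot rig); rewrite transp_map.
  + exact: (add_tile_tiling kt ad).
  + by move=> u; rewrite inE => /predU1P[->|/sD //]; exists y, r, x.
- by clear_lia.
Qed.

Lemma state_init : 0 < n -> state P P 0 (served 0) id.
Proof.
move=> n0; have sm := served_mem k0 PD n0; have Us := served_up k0 PD n0.
split=> //.
- by rewrite leqnn (served_gt k0 PD).
- by rewrite block_start_served // served_notin.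
- move=> i i0; have := mem_queueS k P 0 i; rewrite mem_queue0 /is_up i0 /= => ->.
  rewrite leqn0 (gtn_eqF i0) /=; case: eqP => [->|] /=; last by rewrite orbF.
  by case/andP: Us.
- by move=> i /andP[i0 _]; rewrite /is_up i0.
Qed.

Theorem slides_exist B : 0 < n -> exists D g,
  [/\ exchange P D B (map (map g) B), final g, is_tiling P D
    & forall t, t \in D -> exists y r x, slide P t y r x].
Proof.
move=> n0; have [D [g]] := run B (state_init n0).
have -> : map (map id) B = B by rewrite -[RHS]map_id; apply: eq_map => b; exact: map_id.
by exists D, g.
Qed.

End Run.

(** * Maximality of the tiling *)

Section Maximal.

Variables (k n : nat) (P : kdyck k n).
Hypothesis k0 : 0 < k.
Local Notation N := (k.+1 * n).
Local Notation block_end := (block_end k P).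
Local Notation block_start := (block_start k P).
Local Notation queue := (queue k P).
Local Notation served := (served k P).
Let PD := steps_dyck P.

Let sP : size P = N.
Proof. by case: PD. Qed.

(** The number of up steps beyond [v] which have left the queue before time
    [y]: those have moved to the left across the vertex [v], so this is the
    layer of the box added there at time [y], counted from [0]. *)
Definition served_after (y v : nat) : nat :=
  count (fun u => (v < u) && (u \notin queue y)) (upsteps P).

(** A tile lies in a single layer, since the up steps strictly between its two
    stops are all waiting. *)
Lemma slide_layer t y r x v : slide P t y r x -> r <= v < x ->
  row_at t v = ups P v + served_after y r.
Proof.
case=> yn yr rx xs cr cx btw _ _ th /andP[rv vx].
have yv : y <= v by apply: leq_trans rv; exact: ltnW.
rewrite th ?rv //.
have sq := served_mem k0 PD yn.
have := count_queue k0 PD (ltnW yn) yv.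
rewrite (permP (perm_to_rem sq)) -queueS /= leqNgt (leq_trans vx xs) add0n addnC => ->.
congr (_ + _); rewrite /served_after; apply: eq_in_count => u; rewrite mem_upsteps => Uu.
case: (ltnP v u) => vu; first by rewrite (leq_ltn_trans rv vu).
case: (ltnP r u) => //= ru; apply/esym/negbTE; rewrite negbK.
have ux : u < x by apply: leq_ltn_trans vx.
have := btw u; rewrite ru ux (block_start_up k0 PD Uu) => /(_ isT).
exact: queue_sub.
Qed.

Lemma ups_gt0 v : 0 < v <= N -> 0 < ups P v.
Proof.
case/andP=> v0 vN; case: PD => s _ /(_ v); rewrite s => /(_ vN).
by case: ups => //; rewrite muln0 leqn0 (gtn_eqF v0).
Qed.

(** As the path starts with an up step, no box above it lies in the lowest
    row, so that the predecessor in [shift_box] is not truncated. *)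
Lemma above_height b : above P b -> [/\ 0 < b.2, b.2 < n, ups P (corner b) <= b.2
   & corner (shift_box b) = corner b].
Proof.
rewrite above_kdyck => /andP[bn hb]; have v0 : 0 < corner b by [].
have b0 : 0 < b.2.
  case: (leqP (corner b) N) => vN.
    by apply: leq_trans hb; apply: ups_gt0; rewrite v0.
  move: bn hb; case: PD => s e _; rewrite /ups take_oversize ?s ?(ltnW vN) //.
  by rewrite -[X in _ < X]e /ups take_size; case: b.2; case: count.
by split=> //; rewrite /corner /=; lia.
Qed.

Lemma tiling_mem (E : seq tile) b : is_tiling P E -> above P b ->
  exists2 t, t \in E & b \in tile_boxes t.
Proof. by case=> _ _ mE; rewrite -mE => /flattenP[_ /mapP[t tE ->] bt]; exists t. Qed.

Lemma tiling_above (E : seq tile) t b : is_tiling P E -> t \in E -> b \in tile_boxes t ->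
  above P b.
Proof.
by case=> _ _ mE tE bt; rewrite -mE; apply/flattenP; exists (tile_boxes t); rewrite ?map_f.
Qed.

Lemma uniq_flatten_inj (T S : eqType) (f : T -> seq S) (s : seq T) t u b :
  uniq (flatten (map f s)) -> t \in s -> u \in s -> b \in f t -> b \in f u -> t = u.
Proof.
elim: s => // a s IH /=; rewrite cat_uniq => /and3P[_ /hasPn nh us].
have out v : v \in s -> b \in f v -> b \in f a -> False.
  move=> vs bv; apply/negP/nh/flattenP.
  by exists (f v); rewrite ?map_f.
rewrite !inE => /predU1P[->|ts] /predU1P[->|us'] // bt bu.
- by case: (out u us').
- by case: (out t ts).
- exact: IH.
Qed.

Lemma tiling_inj (E : seq tile) t u b : is_tiling P E -> t \in E -> u \in E ->
  b \in tile_boxes t -> b \in tile_boxes u -> t = u.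
Proof. by case=> _ uE _; apply: uniq_flatten_inj. Qed.

Section Slides.

Variable D : seq tile.
Hypothesis tD : is_tiling P D.
Hypothesis sD : forall t, t \in D -> exists y r x, slide P t y r x.

Lemma slide_range t y r x v : slide P t y r x ->
  (first_corner t <= v <= first_corner t + size t.2) = (r <= v < x).
Proof. by case=> yn yr rx xs cr cx btw -> st _; rewrite st; lia. Qed.

(** In the lowest layer the translated tile is below the path.  Otherwise the
    first translated box belongs to a tile of an earlier time, and this tile
    extends over [t]: its stops lie outside the blocks waiting then, while the
    positions strictly inside [t] belong to blocks which wait even later. *)
Lemma slides_ci : cover_inclusive P D.
Proof.
move=> t tinD; have [y [r [x sl]]] := sD tinD.
have layer v : r <= v < x -> row_at t v = ups P v + served_after y r by apply: slide_layer.
have memt b : b \in tile_boxes t -> [/\ r <= corner b < x, b.2 = ups P (corner b) + served_after y r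
    & above P b].
  move=> bt; have ab := tiling_above tD tinD bt.
  by move: bt; rewrite mem_tile (slide_range _ sl) => /andP[h /eqP ->]; rewrite layer.
case E : (served_after y r) => [|c].
  left=> b /memt [hv]; rewrite E addn0 => b2 /above_height [b0 bn _ vs].
  rewrite above_kdyck vs /= negb_and -ltnNge -b2; apply/orP; right.
  by rewrite -ltnNge prednK.
right; have rx := slide_rx sl.
have h0 : first_corner t <= r <= first_corner t + size t.2 by rewrite (slide_range _ sl) leqnn.
set b0 := box_at r (row_at t r); have b0t : b0 \in tile_boxes t by apply: tile_box.
have [b00 b0n b0u vb0] := above_height (tiling_above tD tinD b0t).
have vb : corner b0 = r by rewrite corner_box_at ?row_at_lt.
have b02 : row_at t r = ups P r + c.+1 by rewrite -E -layer ?leqnn.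
have ab1 : above P (shift_box b0).
  rewrite above_kdyck vb0 vb /=; move: b0n; rewrite /b0 /= b02; move: (ups P r).
  by clear; lia.
have [u uD b0u'] := tiling_mem tD ab1.
have [y' [r' [x' sl']]] := sD uD.
have layer' v : r' <= v < x' -> row_at u v = ups P v + served_after y' r' by apply: slide_layer.
move: b0u'; rewrite mem_tile (slide_range _ sl') vb0 vb => /andP[hr]; rewrite layer' // => /eqP /=.
rewrite b02 addnS /= => /addnI lc.
have yy : y' <= y.
  rewrite leqNgt; apply/negP => /ltnW yy.
  have : served_after y r <= served_after y' r.
    apply: sub_count => v /andP[-> /=]; apply: contra; exact: queue_sub.
  have := slide_layer sl' hr; have [_ _ _ _ _ _ btw' _ _ _] := sl'.
  have -> : served_after y' r = served_after y' r'.
    rewrite /served_after; apply: eq_in_count => v; rewrite mem_upsteps => Uv.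
    case/andP: hr => r'r rx'; case: (ltnP r v) => rv; first by rewrite (leq_ltn_trans r'r rv).
    case: (ltnP r' v) => //= r'v; apply/esym/negbTE; rewrite negbK.
    have := btw' v; rewrite r'v (leq_ltn_trans rv rx') (block_start_up k0 PD Uv) => /(_ isT).
    exact: queue_sub.
  by rewrite E -lc ltnn.
have xx : x <= x'.
  rewrite leqNgt; apply/negP => x'x; case/andP: hr => _ rx'.
  have [_ _ _ _ _ cx' _ _ _ _] := sl'; have [_ _ _ _ _ _ btw _ _ _] := sl.
  by case/negP: cx'; apply: (queue_sub (_ : y'.+1 <= y.+1)) => //; apply: btw; rewrite rx'.
have shu b : b \in tile_boxes t -> shift_box b \in tile_boxes u.
  case/memt=> /andP[rb bx] b2 /above_height [b20 _ _ vs].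
  have hb : r' <= corner b < x'.
    by case/andP: hr => h1 h2; rewrite (leq_trans h1 rb) (leq_trans bx xx).
  by rewrite mem_tile (slide_range _ sl') vs hb layer' //= b2 E -lc addnS.
exists u; split=> //; apply/eqP => ut; move: (shu _ b0t).
rewrite ut mem_tile vb0 vb -/b0 => /andP[_]; rewrite layer ?leqnn // E -b02 /=.
by move: b00; rewrite /b0 /=; case: (row_at t r) => //= m _; rewrite ltn_eqF.
Qed.

(** Suppose that the right stop [x] of a tile belongs to a block inside the
    stretch from [a] to [b] in which the layer [c] is available.  This block
    has been served.  If it was the head of the queue, all up steps after it
    had been served; if it stayed in place, the positions before it had been
    filled by up steps from beyond its end, one for each right step of [P]
    among them.  Either way more than [c] up steps have crossed, so the tile
    is above the layer [c]. *)
Lemma slide_cut_layer t y r x a b c : slide P t y r x ->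
  a < block_start x -> block_end (block_start x) <= b -> b <= N -> ups P a + c < a -> ups P b + c < n ->
  c < served_after y r.
Proof.
move=> sl ax xb bN ac bc; have [yn yr rx xs cr cx btw _ _ _] := sl.
have xN : 0 < x <= size P.
  by have := served_range P k0 yn; rewrite sP; have := xs; lia.
have [oU ox xo] := block_start_mem k0 PD xN.
have [y' yy [oE oq]] := servedP k0 oU cx.
move: (block_start x) ax xb oU ox xo oE oq => z az zb Uz zx xz zE zq.
have rz : r < block_end z by apply: leq_trans xz.
have y'n : y' < n by apply: leq_trans yn.
have late u : is_up P u -> u \notin queue y' -> block_end z < u ->
    (r < u) && (u \notin queue y).
  move=> Uu uq zu; rewrite (ltn_trans rz zu) /=; apply: contra uq; exact: queue_sub.
case: (eqVneq z y'.+1) => [zy|nzy].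
  have := count_queue k0 PD (ltnW y'n) (leqnn y').
  rewrite (@eq_in_count _ _ pred0) ?count_pred0 ?add0n => [cq|u /queue_gt]; last first.
    by move=> h; apply/negbTE; rewrite -ltnNge.
  have ay : a <= y' by rewrite -ltnS -zy.
  have := ups_lip P ay => hl.
  suff : served_after y' y' <= served_after y r by rewrite /served_after in cq *; lia.
  rewrite /served_after -!size_filter; apply: uniq_leq_size; first by rewrite filter_uniq ?uniq_upsteps.
  move=> u; rewrite !(mem_filter _ _ (upsteps P)) mem_upsteps => /andP[/andP[yu uq] Uu].
  rewrite Uu andbT; apply: late => //.
  have gr := greedy k0 PD Uu yu uq zq.
  rewrite ltnNge; apply: contraTN gr => uz; rewrite -leqNgt.
  by apply: (block_end_nest k0 PD) => //; rewrite zy.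
have hd : z = head 0 (queue y') by rewrite zE served_head // -zE.
apply: (@leq_trans (count (fun u => block_end z < u) (upsteps P))).
  have := count_predC (fun u => u <= block_end z) (upsteps P).
  rewrite count_upsteps (size_upsteps PD).
  rewrite (@eq_count _ (predC _) (fun u => block_end z < u)) => [|u]; last by rewrite /= ltnNge.
  by have := ups_mono P zb; lia.
rewrite /served_after -!size_filter; apply: uniq_leq_size; first by rewrite filter_uniq ?uniq_upsteps.
move=> u; rewrite !(mem_filter _ _ (upsteps P)) mem_upsteps => /andP[zu Uu]; rewrite Uu andbT.
apply: late => //; apply/negP => /(head_queue k0 PD); rewrite -hd.
by have [f1 _ _ _] := block_endP k0 PD Uu; lia.
Qed.

(** Cover-inclusion sends a tile into a tile one layer below, or below the
    path; induction on the layer shows that no tile changes layer. *)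
Lemma ci_layer (E : seq tile) : is_ci_tiling P E -> forall t, t \in E ->
  exists c, forall v, first_corner t <= v <= first_corner t + size t.2 -> row_at t v = ups P v + c.
Proof.
move=> [tE ciE] t tinE.
have abv u v : u \in E -> first_corner u <= v <= first_corner u + size u.2 ->
    [/\ 0 < row_at u v, row_at u v < n, ups P v <= row_at u v
    & corner (shift_box (box_at v (row_at u v))) = v].
  move=> uE hv; have := above_height (tiling_above tE uE (tile_box hv)).
  by rewrite corner_box_at ?row_at_lt.
have h0 : first_corner t <= first_corner t <= first_corner t + size t.2 by rewrite leqnn leq_addr.
suff H L : forall u v0, u \in E -> first_corner u <= v0 <= first_corner u + size u.2 ->
    row_at u v0 <= ups P v0 + L ->
    exists c, forall v, first_corner u <= v <= first_corner u + size u.2 -> row_at u v = ups P v + c.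
  by apply: (H (row_at t (first_corner t)) t (first_corner t)) => //; exact: leq_addl.
elim: L => [|L IH] {h0 tinE}t v0 tinE hv0 le.
  exists 0 => v hv.
  case: (ciE t tinE) => [nsh|[u [uE _ shu]]].
    have := nsh _ (tile_box hv); have [a1 a2 a3 a4] := abv t v tinE hv.
    by rewrite above_kdyck a4 /=; lia.
  have := tiling_above tE uE (shu _ (tile_box hv0)); have [a1 a2 a3 a4] := abv t v0 tinE hv0.
  by rewrite above_kdyck a4 /=; lia.
case: (ciE t tinE) => [nsh|[u [uE _ shu]]].
  exists 0 => v hv; have := nsh _ (tile_box hv); have [a1 a2 a3 a4] := abv t v tinE hv.
  by rewrite above_kdyck a4 /=; lia.
have inu v : first_corner t <= v <= first_corner t + size t.2 ->
    (first_corner u <= v <= first_corner u + size u.2) /\ row_at t v = (row_at u v).+1.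
  move=> hv; have := shu _ (tile_box hv); have [a1 a2 a3 a4] := abv t v tinE hv.
  by rewrite mem_tile a4 /= => /andP[-> /eqP <-]; rewrite prednK.
have [hu hL] := inu v0 hv0.
have [|c hc] := IH u v0 uE hu; first by lia.
by exists c.+1 => v /inu [hv ->]; rewrite hc // addnS.
Qed.

(** A tile of any cover-inclusive tiling lies in one layer, so its word is a
    factor of [P], and it contains whole blocks.  By [slide_cut_layer] none of
    the stops of the tile of [D] that contains its first box can be strictly
    inside it. *)
Lemma ci_refines (E : seq tile) : is_ci_tiling P E -> forall t, t \in E ->
  exists2 u, u \in D & tile_sub t u.
Proof.
move=> ciE t tinE; have [c hc] := ci_layer ciE tinE; have [tE _] := ciE.
have abv v : first_corner t <= v <= first_corner t + size t.2 -> above P (box_at v (row_at t v)).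
  by move=> hv; apply: (tiling_above tE tinE); apply: tile_box.
set a := first_corner t in hc abv *; set b := a + size t.2 in hc abv *.
have ab : a <= b by exact: leq_addr.
have ha : a <= a <= b by rewrite leqnn.
have hb : a <= b <= b by rewrite leqnn andbT.
have [u uD fu] := tiling_mem tD (abv a ha).
have [y [r [x sl]]] := sD uD.
have lay v : r <= v < x -> row_at u v = ups P v + served_after y r by apply: slide_layer.
have tlt v : a <= v <= b -> ups P v + c < v by move=> hv; rewrite -hc //; apply: row_at_lt.
have ltn v : a <= v <= b -> ups P v + c < n.
  by move=> hv; have := abv v hv; rewrite above_kdyck hc // => /andP[].
have memu v : a <= v <= b -> (box_at v (row_at t v) \in tile_boxes u) =
    (r <= v < x) && (served_after y r == c).
  move=> hv; rewrite mem_tile corner_box_at ?hc ?tlt // (slide_range _ sl).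
  by case: (boolP (r <= v < x)) => // hr; rewrite lay // eqn_add2l eq_sym.
move: fu; rewrite memu // => /andP[ra /eqP lc].
have bN : b <= N.
  have : ups P b < n by apply: leq_ltn_trans (ltn b hb); exact: leq_addr.
  case: (leqP b N) => // bN; case: PD => s e _.
  by rewrite /ups take_oversize ?s ?(ltnW bN) // -[X in _ < X]e /ups take_size ltnn.
have fac : t.2 = factor P a b.
  have st : size t.2 = b - a by rewrite /b addKn.
  apply: ups_inj => [|i hi]; first by rewrite size_factor ?sP.
  have := hc a ha; have := hc (a + i); rewrite /row_at -/a subnn ups0 addKn.
  rewrite (@ups_factor P a b) /b ?leq_add2l //; rewrite leq_addr hi => /(_ isT).
  by rewrite addn0; set z := ups (factor _ _ _) i; move: (ups P a) (ups t.2 i) z; clear; lia.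
have [kE _ _] := tE; have [m] := kE t tinE; rewrite fac => mD.
have ur v : a <= v <= b -> v < x.
  case/andP; move=> av; rewrite -(subnKC av); elim: (v - a) => [|d IH] hd.
    by rewrite addn0; case/andP: ra.
  have vx : a + d < x by apply: IH; apply: leq_trans hd; rewrite leq_add2l.
  rewrite addnS in hd *; rewrite ltn_neqAle vx andbT; apply/eqP => Ex.
  have bP : b <= size P by rewrite sP.
  have xr : a < x <= b by rewrite -Ex ltnS leq_addr.
  have [ax xb] := factor_closed k0 PD ab bP mD xr.
  by have := slide_cut_layer sl ax xb bN (tlt a ha) (ltn b hb); rewrite lc ltnn.
exists u => // z zt.
have := zt; rewrite mem_tile -/a -/b => /andP[hz /eqP z2].
rewrite (box_atE z) z2 memu // lc eqxx andbT (ur _ hz) andbT.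
by case/andP: ra => r1 _; case/andP: hz => h1 _; apply: leq_trans h1.
Qed.

Lemma slides_max : is_max_tiling P D.
Proof.
split; first by split=> //; exact: slides_ci.
move=> E ciE DE; have [tE _] := ciE.
have sub u : u \in D -> exists2 t, t \in E & tile_sub u t by exact: DE.
have box1 (t : tile) : box_at (first_corner t) (row_at t (first_corner t)) \in tile_boxes t.
  by apply: tile_box; rewrite leqnn leq_addr.
have eqD u t : u \in D -> t \in E -> tile_sub u t -> u = t.
  move=> uD tinE ut; have [u' u'D tu'] := ci_refines ciE tinE.
  have uu' : u = u' by apply: (tiling_inj tD uD u'D (box1 u)); apply/tu'/ut/box1.
  by apply: tile_ext => //; rewrite uu'.
move=> t; apply/idP/idP => [tinE|tD']; last first.
  by have [u uE tu] := sub t tD'; rewrite (eqD t u).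
have [u uD tu] := ci_refines ciE tinE; have [v vE uv] := sub u uD.
have tv : t = v by apply: (tiling_inj tE tinE vE (box1 t)); apply/uv/tu/box1.
by rewrite tv -(eqD u v).
Qed.

Lemma max_tiling_unique (E : seq tile) : is_max_tiling P E -> D =i E.
Proof.
case=> ciE mE; apply: mE; first by split=> //; exact: slides_ci.
exact: ci_refines.
Qed.

End Slides.
End Maximal.

(** * Independence of the order of the tiles *)

(** The bottom edge of the first box and the right edge of the last box of a
    tile have these indices on any path to which the tile can be added. *)
Definition tile_transp (t : tile) : nat -> nat := transp (first_corner t) (first_corner t + size t.2).+1.

Definition exchange_all (B : seq (seq nat)) (D : seq tile) : seq (seq nat) :=
  foldl (fun B t => map (map (tile_transp t)) B) B D.

(** Some box of [t] lies weakly below and to the right of a box of [u], so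
    that [t] must be added before [u]. *)
Definition tile_below (t u : tile) : bool :=
  has (fun b => has (box_le b) (tile_boxes u)) (tile_boxes t).

Lemma exchange_allE k n (p : kdyck k n) D B C : exchange p D B C -> C = exchange_all B D.
Proof.
elim=> // {p D B C} p q t D i j B C _.
case/and3P=> /andP[i0 ip] _ /eqP vi /and3P[/andP[j0 jp] _ /eqP vj] _ ->.
have -> : i = first_corner t.
  by rewrite /first_corner -/(first_box t) -vi corner_vertex ?prednK // (leq_trans (leq_pred _)).
have -> // : j = (first_corner t + size t.2).+1.
have hv : first_corner t <= first_corner t + size t.2 <= first_corner t + size t.2 by rewrite leqnn leq_addr.
have <- : corner (last_box t) = first_corner t + size t.2.
  by rewrite last_box_tile corner_box_at // row_at_lt.
rewrite -[LHS](prednK j0) -(@corner_vertex p) ?vj //.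
by rewrite (leq_trans (leq_pred _)).
Qed.

Lemma exchange_above k n (p : kdyck k n) D B C : exchange p D B C ->
  forall t b, t \in D -> b \in tile_boxes t -> above p b.
Proof.
elim=> // {p D B C} p q t D i j B C [tab aq] _ _ _ IH u b.
rewrite inE => /predU1P[->|uD bu]; first exact: tab.
by have := IH u b uD bu; rewrite aq => /andP[].
Qed.

Lemma above_up k n (p : kdyck k n) b c : c.2 < n -> box_le b c -> above p b -> above p c.
Proof.
case: b c => x y [x' y'] /= yn /andP[/= h1 h2].
rewrite !above_kdyck yn /corner /= => /andP[_ h].
have [h3|h3] := leqP (x' + y').+1 (x + y).+1.
  by apply: leq_trans (leq_trans h h2); apply: ups_mono.
by have := @ups_lip p (x + y).+1 (x' + y').+1; lia.
Qed.

Lemma exchange_order k n (p : kdyck k n) D B C : exchange p D B C ->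
  pairwise (fun x t => ~~ tile_below t x) D.
Proof.
elim=> // {p D B C} p q t D i j B C [tab aq] _ _ ex IH /=; rewrite IH andbT.
apply/allP => u uD; apply/hasPn => b bu; apply/hasPn => c ct; apply/negP => bc.
have := exchange_above ex uD bu; have := tab c ct => ac ab.
have cn : c.2 < n by move: ac; rewrite above_kdyck => /andP[].
by have := above_up cn bc ab; rewrite aq ct andbF.
Qed.

(** Boxes on equal or adjacent antidiagonals are always comparable, so
    incomparable tiles are at least two antidiagonals apart and exchange
    disjoint pairs of integers. *)
Lemma tile_transp_comm t u : ~~ tile_below t u -> ~~ tile_below u t -> forall B,
  map (map (tile_transp t)) (map (map (tile_transp u)) B) = map (map (tile_transp u)) (map (map (tile_transp t)) B).
Proof.
move=> tu ut B; rewrite -!map_comp; apply: eq_map => b /=.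
rewrite -!map_comp; apply: eq_map => i /=.
have cmp v v' : first_corner t <= v <= first_corner t + size t.2 -> first_corner u <= v' <= first_corner u + size u.2 ->
    v <= v'.+1 -> v' <= v.+1 -> False.
  move=> hv hv' le1 le2; have bt := tile_box hv; have bu := tile_box hv'.
  have lt := row_at_lt hv; have lt' := row_at_lt hv'.
  have {}tu : ~~ box_le (box_at v (row_at t v)) (box_at v' (row_at u v')).
    by have /hasPn/(_ _ bt)/hasPn/(_ _ bu) := tu.
  have {}ut : ~~ box_le (box_at v' (row_at u v')) (box_at v (row_at t v)).
    by have /hasPn/(_ _ bu)/hasPn/(_ _ bt) := ut.
  by move: tu ut; rewrite /box_le /=; lia.
have sep : (first_corner t + size t.2).+1 < first_corner u \/ (first_corner u + size u.2).+1 < first_corner t.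
  have [h1|h1] := ltnP (first_corner t + size t.2).+1 (first_corner u); first by left.
  have [h2|h2] := ltnP (first_corner u + size u.2).+1 (first_corner t); first by right.
  case: (leqP (first_corner t) (first_corner u)) => h.
    by case: (cmp (minn (first_corner u) (first_corner t + size t.2)) (first_corner u)); lia.
  by case: (cmp (first_corner t) (minn (first_corner t) (first_corner u + size u.2))); lia.
rewrite /tile_transp; move: sep; move: (first_corner t) (size t.2) (first_corner u) (size u.2) => a la c lc sep.
have T x y m : (m = x /\ transp x y m = y) \/ (m = y /\ transp x y m = x) \/
    (m <> x /\ m <> y /\ transp x y m = m).
  by rewrite /transp; case: eqP => [->|?]; [|case: eqP => [->|?]]; lia.
have := T a (a + la).+1 i; have := T c (c + lc).+1 i.
have := T a (a + la).+1 (transp c (c + lc).+1 i).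
by have := T c (c + lc).+1 (transp a (a + la).+1 i); clear -sep; lia.
Qed.

(** The first tile of one sequence can be moved to the front of the other: the
    tiles before it there are incomparable to it. *)
Lemma exchange_all_perm D D' B : pairwise (fun x t => ~~ tile_below t x) D ->
  pairwise (fun x t => ~~ tile_below t x) D' -> perm_eq D D' -> exchange_all B D = exchange_all B D'.
Proof.
elim: D D' B => [|t D IH] D' B; first by move=> _ _ /perm_size/esym/size0nil ->.
move=> /= /andP[tD pD] pD' pe.
have tin : t \in D' by rewrite -(perm_mem pe) mem_head.
case/splitPr: tin pD' pe => X Y; rewrite pairwise_cat /= => /and3P[aXY pX /andP[tY pY]] pe.
have pXY : pairwise (fun x t => ~~ tile_below t x) (X ++ Y).
  rewrite pairwise_cat pX pY !andbT; apply/allrelP => a b aX bY.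
  by have /allrelP := aXY; apply=> //; rewrite inE bY orbT.
have {}pe : perm_eq D (X ++ Y).
  by rewrite -(perm_cons t) (perm_trans pe) // (permEl (perm_catCA X [:: t] Y)).
rewrite (IH (X ++ Y)) // /exchange_all !foldl_cat /=; congr foldl.
have : all (fun x => ~~ tile_below t x && ~~ tile_below x t) X.
  apply/allP => x xX; have /allrelP/(_ x t xX (mem_head _ _)) -> := aXY.
  by have /allP := tD; apply; rewrite (perm_mem pe) mem_cat xX.
elim: X B {aXY pX pXY pe} => // x X IHX B /= /andP[/andP[h1 h2] aX].
by rewrite tile_transp_comm // IHX.
Qed.

(** * The blocks of the matching *)

Section Blocks.

Variables (k n : nat) (P : kdyck k n).
Hypothesis k0 : 0 < k.
Local Notation N := (k.+1 * n).
Local Notation block_end := (block_end k P).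
Local Notation block_start := (block_start k P).
Local Notation queue := (queue k P).
Local Notation served := (served k P).
Let PD := steps_dyck P.

Let sP : size P = N.
Proof. by case: PD. Qed.

Definition block_rights (u : nat) : seq nat :=
  [seq i <- iota 1 N | ~~ letter P i && (block_start i == u)].

Lemma count_sum (T S : eqType) (a : pred T) (f : T -> S) (s : seq T) (V : seq S) :
  uniq V -> (forall i, i \in s -> a i -> f i \in V) ->
  count a s = \sum_(v <- V) count (fun i => a i && (f i == v)) s.
Proof.
move=> uV; elim: s => [|i s IH] h /=; first by rewrite big1.
rewrite big_split /= -IH => [|j js]; last by apply: h; rewrite inE js orbT.
congr (_ + _); case: (boolP (a i)) => ai /=; last by rewrite big1.
have fV := h i (mem_head _ _) ai.
rewrite (bigD1_seq (f i)) //= eqxx big1 ?addn0 // => v /negbTE.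
by rewrite eq_sym => ->.
Qed.

Lemma mem_block_rights u i : (i \in block_rights u) =
  [&& 0 < i <= N, ~~ letter P i & block_start i == u].
Proof. by rewrite mem_filter mem_iota add1n ltnS andbC. Qed.

Lemma block_rights_range u i : i \in block_rights u -> u < i <= block_end u.
Proof.
rewrite mem_block_rights => /and3P[iN Li /eqP <-]; have {}iN : 0 < i <= size P by rewrite sP.
have [_ _ ->] := block_start_mem k0 PD iN; rewrite andbT; apply: (block_start_right k0 PD) => //.
by rewrite /is_up (negbTE Li) andbF.
Qed.

(** A balanced span contains [k] right steps for each of its up steps; by
    induction on the length of the span every inner block has [k] of them, and
    so [k] are left for [u]. *)
Lemma size_block_rights u : is_up P u -> size (block_rights u) = k.
Proof.
have [m le] := ubnP (block_end u - u); elim: m => // m IH in u le *; move=> Uu.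
have [f1 f2 f3 _] := block_endP k0 PD Uu; have u0 : 0 < u by case/andP: Uu.
pose V := [seq v <- upsteps P | u <= v <= block_end u].
have uV : uniq V by rewrite filter_uniq ?uniq_upsteps.
have memV v : (v \in V) = (u <= v <= block_end u) && is_up P v.
  by rewrite (mem_filter _ _ (upsteps P)) mem_upsteps.
have sV : size V + ups P u.-1 = ups P (block_end u).
  rewrite size_filter -!count_upsteps.
  have := count_predUI (fun v => u <= v <= block_end u) (fun v => v <= u.-1) (upsteps P).
  rewrite [X in _ + X = _](@eq_count _ _ pred0) ?count_pred0 => [|v] /=; last by lia.
  by rewrite addn0 => <-; apply: eq_count => v /=; lia.
have cR : count (fun i => ~~ letter P i) (iota u (block_end u - u.-1)) = k * size V.
  have := count_predC (letter P) (iota u (block_end u - u.-1)); rewrite size_iota.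
  have := ups_count P (block_end u); rewrite -{1 2}(subnKC (_ : u.-1 <= block_end u)); last by lia.
  rewrite iotaD count_cat -ups_count add1n prednK // subnKC; last by lia.
  rewrite -[count (predC _) _]/(count (fun i => ~~ letter P i) _).
  by clear_lia.
have inV i : u <= i <= block_end u -> block_start i \in V.
  move=> iu; have iN : 0 < i <= size P by clear_lia.
  have [oU oi io] := block_start_mem k0 PD iN; rewrite memV oU andbT.
  have := block_start_max k0 Uu; move=> /(_ i); clear_lia.
have E : k * size V = \sum_(v <- V)
    count (fun i => ~~ letter P i && (block_start i == v)) (iota u (block_end u - u.-1)).
  rewrite -cR; apply: count_sum => // i; rewrite mem_iota => h _; apply: inV; clear_lia.
have fib v : v \in V ->
    count (fun i => ~~ letter P i && (block_start i == v)) (iota u (block_end u - u.-1)) = size (block_rights v).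
  rewrite memV => /andP[/andP[uv vf] Uv]; rewrite -size_filter.
  apply/perm_size/uniq_perm; rewrite ?filter_uniq ?iota_uniq // => i.
  have := @block_rights_range v i; rewrite mem_block_rights mem_filter mem_iota.
  have := block_end_nest k0 PD Uu Uv uv vf.
  case: (letter P i); rewrite /= ?andbF //.
  by case: (block_start i == v); rewrite ?andbF ?andbT //=; clear_lia.
have uinV : u \in V by rewrite memV leqnn ltnW.
rewrite (eq_big_seq _ fib) (bigD1_seq u) //= in E.
have Ek : \sum_(v <- V | v != u) size (block_rights v) = k * (size V).-1.
  rewrite big_seq_cond (@eq_bigr _ _ _ _ _ _ _ (fun _ => k)) => [|v /andP[]]; last first.
    rewrite memV => /andP[/andP[uv vf] Uv] vu; have := block_end_nest k0 PD Uu Uv uv vf.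
    have [g1 _ _ _] := block_endP k0 PD Uv => vf'.
    by apply: IH => //; move/eqP: vu; clear_lia.
  rewrite -big_seq_cond big_const_seq iter_addn addn0; congr (_ * _).
  by have := count_predC (pred1 u) V; rewrite count_uniq_mem // uinV => <-.
have : 0 < size V by case: (V) uinV.
by move: E; rewrite Ek; clear; case: (size V) => // m; rewrite mulnS /=; lia.
Qed.

End Blocks.

(** * The collection of blocks after all exchanges *)

Section Formula.

Variables (k n : nat) (P : kdyck k n).
Hypothesis k0 : 0 < k.
Local Notation N := (k.+1 * n).
Local Notation block_end := (block_end k P).
Local Notation block_start := (block_start k P).
Local Notation queue := (queue k P).
Local Notation served := (served k P).
Local Notation block_rights := (block_rights P).
Let PD := steps_dyck P.

Let sP : size P = N.
Proof. by case: PD. Qed.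

(** When [u] is processed, the unused right steps after it belong to [u],
    which come up to [block_end u], or to earlier up steps, and those come
    after it. *)
Lemma match_blocks_block_rights s s2 : upsteps P = s ++ s2 ->
  match_blocks k (rev s) [seq i <- iota 1 N | ~~ letter P i && (block_start i \notin s2)]
  = [seq u :: block_rights u | u <- rev s].
Proof.
elim/last_ind: s s2 => [//|s u IH] s2 E.
rewrite rev_rcons /=; have Uu : is_up P u.
  by rewrite -mem_upsteps E mem_cat mem_rcons mem_head.
have [f1 f2 _ _] := block_endP k0 PD Uu; have u0 : 0 < u by case/andP: Uu.
have uE := uniq_upsteps P; rewrite E in uE.
have us2 : u \notin s2.
  move: uE; rewrite cat_uniq => /and3P[_ /hasPn h _]; apply/negP => /h.
  by rewrite mem_rcons mem_head.
have slt v : v \in s -> v < u.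
  have : sorted ltn (upsteps P) by apply: sorted_filter; [exact: ltn_trans|exact: iota_ltn_sorted].
  rewrite E cat_rcons (sorted_pairwise ltn_trans) pairwise_cat => /and3P[/allrelP h _ _] vs.
  by apply: h; rewrite // mem_head.
have tk : take k [seq i <- [seq i <- iota 1 N | ~~ letter P i && (block_start i \notin s2)] | u < i]
    = block_rights u.
  have iN : iota 1 N = iota 1 (block_end u) ++ iota (block_end u).+1 (N - block_end u).
    by rewrite -iotaD subnKC //; move: f2; rewrite sP.
  rewrite -filter_predI iN filter_cat.
  have -> : [seq i <- iota 1 (block_end u) | predI (fun i => u < i)
      (fun i => ~~ letter P i && (block_start i \notin s2)) i] = block_rights u.
    rewrite /block_rights iN filter_cat [X in _ = _ ++ X](@eq_in_filter _ _ pred0) => [|i].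
      rewrite filter_pred0 cats0; apply: eq_in_filter => i; rewrite mem_iota => hi /=.
      have iP : 0 < i <= size P by clear_lia.
      case: (boolP (letter P i)) => Li /=; first by rewrite andbF.
      have Ri : ~~ is_up P i by rewrite /is_up (negbTE Li) andbF.
      have [oU oi io] := block_start_mem k0 PD iP; have ow := block_start_right k0 PD iP Ri.
      apply/andP/eqP => [[ui nos2]|ou]; last by rewrite ou; split=> //; rewrite -ou.
      have uo : u <= block_start i by apply: (block_start_max k0 Uu); clear_lia.
      have : block_start i \in upsteps P by rewrite mem_upsteps.
      rewrite E mem_cat (negbTE nos2) orbF mem_rcons inE => /predU1P[//|/slt].
      by rewrite ltnNge uo.
    rewrite mem_iota => hi /=; apply/negbTE; rewrite negb_and negbK.
    case: (boolP (letter P i)) => //= Li; apply/eqP => ou.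
    have iP : 0 < i <= size P by clear_lia.
    by have [_ _] := block_start_mem k0 PD iP; rewrite ou; clear_lia.
  by rewrite take_size_cat // size_block_rights.
rewrite tk; congr (_ :: _); rewrite -(IH (u :: s2)) ?E ?cat_rcons //.
congr match_blocks; rewrite -filter_predI; apply: eq_in_filter => i.
rewrite mem_iota add1n ltnS => hi /=; rewrite mem_block_rights hi /= inE negb_or andbC.
by case: (letter P i) => //=; rewrite andbC.
Qed.

Lemma matching_block_rights : matching k P = [seq u :: block_rights u | u <- rev (upsteps P)].
Proof.
rewrite /matching sP -(@match_blocks_block_rights (upsteps P) [::]) ?cats0 //.
rewrite /upsteps sP; congr match_blocks; apply: eq_filter => i.
by rewrite in_nil andbT.
Qed.

Variable g : nat -> nat.
Hypothesis gF : final P g.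
Let C := map (map g) (matching k P).

Lemma mem_block b : b \in C ->
  exists2 u, is_up P u & b = map g (u :: block_rights u).
Proof.
case/mapP=> b'; rewrite matching_block_rights => /mapP[u]; rewrite mem_rev mem_upsteps.
by move=> Uu -> ->; exists u.
Qed.

(** The labels are the positions of the up steps at the end, so the block that
    contains a label is the one served at that time. *)
Lemma block_ofE l : l < n -> block_of C l.+1 = map g (served l :: block_rights (served l)).
Proof.
move=> ln; have gl := final_lab gF ln; have Us := served_up k0 PD ln.
have hb : has (fun b => l.+1 \in b) C.
  apply/hasP; exists (map g (served l :: block_rights (served l))).
    apply: map_f; rewrite matching_block_rights; apply: map_f.
    by rewrite mem_rev mem_upsteps.
  by rewrite /= gl mem_head.
have := nth_find [::] hb; rewrite /block_of; set b := nth _ _ _ => lb.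
have bC : b \in C by rewrite mem_nth // -has_find.
have [u Uu bE] := mem_block bC; move: lb; rewrite bE => /mapP[i iu gi].
have uN : 0 < u <= N by have := Uu => /andP[u0 /letter_le_size]; rewrite sP u0.
have iN : 0 < i <= N.
  by move: iu; rewrite inE mem_block_rights => /predU1P[->//|/andP[]].
have E : i = served l by apply: (arr_inj (final_arr gF)); rewrite ?served_range ?gl.
move: iu; rewrite E inE mem_block_rights => /predU1P[->//|/and3P[_ nL _]].
by case/andP: Us => _; rewrite (negbTE nL).
Qed.

Lemma right_gt u i : i \in block_rights u -> n < g i.
Proof.
rewrite mem_block_rights => /and3P[iN Li _]; apply: (final_right gF) => //.
by rewrite /is_up (negbTE Li) andbF.
Qed.

Lemma block_of'E l : l < n -> block_of' C l.+1 = map g (block_rights (served l)).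
Proof.
move=> ln; rewrite /block_of' block_ofE //= (final_lab gF ln) eqxx /=.
apply/all_filterP/allP => x /mapP[i /right_gt lt ->].
by rewrite gtn_eqF // (leq_ltn_trans ln).
Qed.

Lemma seq_min_head x s : all (leq x) s -> seq_min (x :: s) = x.
Proof.
rewrite /seq_min /= => h; suff -> : foldr minn x s = x by rewrite minnn.
by elim: s h => //= a s IH /andP[xa /IH ->]; apply/minn_idPr.
Qed.

Definition first_right (u : nat) : nat := head 0 (block_rights u).

Lemma first_right_mem u : is_up P u -> first_right u \in block_rights u.
Proof.
move=> Uu; have := size_block_rights k0 Uu; rewrite /first_right.
by case: (block_rights u) => [/=|a s _]; [case: k k0|exact: mem_head].
Qed.

Lemma first_right_min u i : i \in block_rights u -> first_right u <= i.
Proof.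
have : sorted ltn (block_rights u) by apply: sorted_filter; [exact: ltn_trans|exact: iota_ltn_sorted].
rewrite /first_right; case: (block_rights u) => //= a s.
rewrite (path_sortedE ltn_trans) inE => /andP[/allP h _] /predU1P[->//|/h].
exact: ltnW.
Qed.

Lemma seq_min_block_rights u : is_up P u -> seq_min (map g (block_rights u)) = g (first_right u).
Proof.
move=> Uu; have fm := first_right_mem Uu; have fmin := @first_right_min u.
have E : block_rights u = first_right u :: behead (block_rights u).
  by rewrite /first_right; case: (block_rights u) fm.
rewrite E /=; apply: seq_min_head; apply/allP => x /mapP[i ib ->] /=.
have ir : i \in block_rights u by rewrite E inE ib orbT.
case: (ltngtP (first_right u) i) (fmin i ir) => // [lt _|-> //].
move: fm ir; rewrite !mem_block_rights => /and3P[fN Lf /eqP of_] /and3P[iN Li /eqP oi].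
apply/ltnW/(arr_ord (final_arr gF)); rewrite ?of_ ?oi //; try by lia.
by rewrite /is_up (negbTE Lf) andbF.
Qed.

(** The right steps, in [P], of the blocks which get the labels [1, ..., m]. *)
Definition placed_rights (m : nat) : seq nat :=
  [seq i <- iota 1 N | ~~ letter P i && (block_start i \notin queue m)].

Lemma placed_rights_served m i : m <= n -> i \in placed_rights m ->
  exists2 l, l < m & i \in block_rights (served l).
Proof.
move=> mn; rewrite mem_filter mem_iota add1n ltnS => /andP[/andP[Li nq] iN].
have iP : 0 < i <= size P by rewrite sP.
have [oU _ _] := block_start_mem k0 PD iP; have [l lm [ol _]] := servedP k0 oU nq.
by exists l; rewrite // mem_block_rights iN Li ol eqxx.
Qed.

Lemma served_placed_rights m i l : l < m -> i \in block_rights (served l) -> i \in placed_rights m.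
Proof.
move=> lm; rewrite mem_block_rights mem_filter mem_iota add1n ltnS => /and3P[-> -> /eqP ->].
by rewrite andbT /=; apply/negP => /(queue_sub lm); apply/negP/served_notin.
Qed.

Lemma size_placed_rights m : m <= n -> size (placed_rights m) = m * k.
Proof.
move=> mn; pose V := [seq served l | l <- iota 0 m].
have uV : uniq V.
  rewrite map_inj_in_uniq ?iota_uniq // => l l'; rewrite !mem_iota /= => h h'.
  by apply: (served_inj k0 PD); [apply: leq_trans mn|apply: leq_trans mn].
rewrite size_filter (@count_sum _ _ _ block_start _ V) // => [|i iN h]; last first.
  have ig : i \in placed_rights m by rewrite mem_filter h.
  have [l lm] := placed_rights_served mn ig; rewrite mem_block_rights => /and3P[_ _ /eqP ->].
  by apply: map_f; rewrite mem_iota.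
rewrite big_map (eq_big_seq (fun _ => k)) => [|l]; last first.
  rewrite mem_iota /= => lm; have Us := served_up k0 PD (leq_trans lm mn).
  apply: etrans (size_block_rights k0 Us).
  rewrite size_filter; apply: eq_in_count => i; rewrite mem_iota => iN.
  case: (eqVneq (block_start i) (served l)) => [->|]; rewrite ?andbF ?andbT //.
  rewrite -[RHS]andbT; congr andb; apply/negP => /(queue_sub lm).
  exact/negP/served_notin.
by rewrite big_const_seq iter_addn addn0 count_predT size_iota mulnC.
Qed.

Lemma perm_image : perm_eq (map g (iota 1 N)) (iota 1 N).
Proof.
have u1 : uniq (map g (iota 1 N)).
  rewrite map_inj_in_uniq ?iota_uniq // => i j; rewrite !mem_iota add1n !ltnS.
  exact: (arr_inj (final_arr gF)).
apply: uniq_perm; rewrite ?iota_uniq //.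
apply: (uniq_min_size u1 _ _).2; last by rewrite size_map.
move=> x /mapP[i]; rewrite !mem_iota add1n !ltnS => iN ->.
exact: (arr_dom (final_arr gF)).
Qed.

(** The conserved sum of [arr_cnt] for the first right step of the block
    served at time [m], evaluated on [P]. *)
Definition reach (m : nat) : nat :=
  first_right (served m) +
  count (fun j => (block_start j \in queue m) && (first_right (served m) < j)) (iota 1 N).

(** [ylen] counts the right steps of the blocks with smaller labels which end
    up beyond the first right step [M] of the block; the [N - M] letters
    beyond [M] are these and the letters of the blocks waiting at time [m]. *)
Lemma ylenE m : m < n -> ylen k n C (n - m) + reach m = N.
Proof.
move=> mn; have Us := served_up k0 PD mn; have fm := first_right_mem Us.
set f := first_right (served m) in fm *; set M := g f.
have fN : 0 < f <= N by move: fm; rewrite mem_block_rights => /andP[].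
have fo : block_start f = served m by move: fm; rewrite mem_block_rights => /and3P[_ _ /eqP].
have Rf : ~~ is_up P f by move: fm; rewrite /is_up mem_block_rights negb_and => /and3P[_ ->]; rewrite orbT.
have nM : n < M by apply: right_gt fm.
have kap : kappa n C (n - m) = count (fun i => g i < M) (placed_rights m).
  rewrite /kappa (_ : n.+1 - (n - m) = m.+1); last by lia.
  rewrite (_ : n - (n - m) = m); last by lia.
  rewrite block_of'E // seq_min_block_rights // -/f -/M -(count_map g (fun j => j < M)).
  apply/permP/uniq_perm; rewrite ?undup_uniq //.
    rewrite map_inj_in_uniq ?filter_uniq ?iota_uniq // => i j.
    rewrite !mem_filter !mem_iota add1n !ltnS => /andP[_ hi] /andP[_ hj].
    exact: (arr_inj (final_arr gF)).
  move=> x; rewrite mem_undup; apply/flattenP/mapP => [[s /mapP[l]]|[i ig ->]].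
    rewrite mem_iota; case: l => // l; rewrite add1n => /andP[_ lm'] ->.
    have lm : l < m by [].
    rewrite (block_of'E (ltn_trans lm mn)) => /mapP[i ir ->].
    by exists i => //; apply: served_placed_rights ir.
  have [l lm ir] := placed_rights_served (ltnW mn) ig.
  exists (map g (block_rights (served l))); last exact: map_f.
  by apply/mapP; exists l.+1; rewrite ?mem_iota ?(block_of'E (ltn_trans lm mn)).
have yl : ylen k n C (n - m) = count (fun i => M < g i) (placed_rights m).
  rewrite /ylen kap (_ : n - (n - m) = m); last by lia.
  rewrite -(size_placed_rights (ltnW mn)) -(count_predC (fun i => g i < M) (placed_rights m)) addKn.
  apply: eq_in_count => i; rewrite mem_filter mem_iota add1n ltnS => /andP[/andP[_ nq] iN].
  rewrite /= -leqNgt leq_eqVlt; case: eqP => //= /esym E.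
  have := arr_inj (final_arr gF) iN fN E => E'; move: nq.
  by rewrite E' fo (served_mem k0 PD mn).
have cnt := arr_cnt (final_arr gF) mn fN Rf fo.
rewrite yl /reach -/f -{}cnt -/M.
have tot : count (fun i => M < g i) (iota 1 N) = N - M.
  rewrite -(count_map g (fun j => M < j)) (permP perm_image).
  have MN : M <= N by have /andP[] := arr_dom (final_arr gF) fN.
  have := @count_between M N.+1 N; rewrite ltnS MN => /(_ isT (leqnn _)) /= <-.
  by apply: eq_in_count => j; rewrite mem_iota; lia.
have MN : M <= N by have /andP[] := arr_dom (final_arr gF) fN.
have := count_predUI (fun i => [&& ~~ letter P i, block_start i \notin queue m & M < g i])
  (fun i => (block_start i \in queue m) && (M < g i)) (iota 1 N).
rewrite [X in _ + X = _](@eq_count _ _ pred0) ?count_pred0 => [|i]; last first.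
  by rewrite /=; case: (block_start i \in _); rewrite ?andbF.
rewrite (@eq_in_count _ (predU _ _) (fun i => M < g i)) => [|i]; last first.
  rewrite mem_iota add1n ltnS /= => iN.
  case: (boolP (letter P i)) => [Li|_] /=; last by case: (block_start i \in _); rewrite ?orbF.
  have Ui : is_up P i by rewrite /is_up Li andbT; case/andP: iN.
  have nq : i \notin queue n.
    have := size_queue k0 PD (leqnn n); rewrite subnn => /size0nil ->.
    by rewrite in_nil.
  have [l ln [il _]] := servedP k0 Ui nq.
  by rewrite il (final_lab gF ln) [M < _]ltnNge (ltnW (leq_ltn_trans ln nM)) andbF.
rewrite tot addn0 /placed_rights count_filter => E.
have {}E : N - M = count (fun i => M < g i) [seq i <- iota 1 N | ~~ letter P i && (block_start i \notin queue m)]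
   + count (fun i => (block_start i \in queue m) && (M < g i)) (iota 1 N).
  rewrite E count_filter; congr (_ + _); apply: eq_count => i /=.
  by case: (letter P i) (_ \in _) (_ < _) => [] [] [].
by rewrite count_filter in E; rewrite addnCA -E subnKC.
Qed.

End Formula.

(** * The rows of the image *)

Section Rows.

Variables (k n : nat) (P : kdyck k n).
Hypothesis k0 : 0 < k.
Local Notation N := (k.+1 * n).
Local Notation block_end := (block_end k P).
Local Notation block_start := (block_start k P).
Local Notation queue := (queue k P).
Local Notation served := (served k P).
Let PD := steps_dyck P.

Let sP : size P = N.
Proof. by case: PD. Qed.

(** The largest end of a block which waits at time [y]. *)
Definition last_end (y : nat) : nat := block_end (head 0 (queue y)).

Lemma queue_head y : y < n -> head 0 (queue y) \in queue y.
Proof.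
move=> yn; have := size_queue k0 PD (ltnW yn).
by case: (queue y) => [/=|a s _]; [lia|exact: mem_head].
Qed.

Lemma last_end_le y : y < n -> last_end y <= N.
Proof.
move=> yn; have [_ f2 _ _] := block_endP k0 PD (queue_up (queue_head yn)).
by move: f2; rewrite sP.
Qed.

Lemma last_end_mono y : y.+1 < n -> last_end y.+1 <= last_end y.
Proof.
move=> yn; apply: (head_queue k0 PD); apply: (queue_sub (leqnSn y)).
exact: queue_head.
Qed.

Lemma reach_le m : m < n -> reach P m <= last_end m.
Proof.
move=> mn; have Us := served_up k0 PD mn; have := first_right_mem k0 Us.
rewrite /reach; move: (first_right P (served m)) => f fr.
have /andP[_ ff] := block_rights_range k0 fr.
have hs := head_queue k0 PD (served_mem k0 PD mn).
have fh : f <= last_end m by apply: leq_trans hs.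
rewrite -leq_subRL //; apply: (@leq_trans (count (fun j => f < j < (last_end m).+1) (iota 1 N))).
  rewrite -!size_filter; apply: uniq_leq_size => [|j]; first by rewrite filter_uniq ?iota_uniq.
  rewrite !mem_filter mem_iota add1n ltnS => /andP[/andP[oq ->] jN]; rewrite jN andbT /=.
  have jP : 0 < j <= size P by rewrite sP.
  have [_ _ jo] := block_start_mem k0 PD jP; rewrite ltnS (leq_trans jo) //.
  exact: (head_queue k0 PD oq).
by rewrite count_between // ltnS (last_end_le mn).
Qed.

(** All the letters from the first right step of the head of the queue to the
    end of its block belong to waiting blocks, and no letter after it does. *)
Lemma reach_head m : m < n -> served m = head 0 (queue m) -> reach P m = last_end m.
Proof.
move=> mn hd; have Us := served_up k0 PD mn; have := first_right_mem k0 Us.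
rewrite /reach; move: (first_right P (served m)) => f fr.
have /andP[sf] := block_rights_range k0 fr; rewrite hd => ff.
rewrite (@eq_in_count _ _ (fun j => f < j < (last_end m).+1)) => [|j].
  by rewrite count_between ?ltnS ?(last_end_le mn) // subnKC.
rewrite mem_iota add1n !ltnS => jN; case: (ltnP f j) => fj; last by rewrite andbF.
rewrite andbT /=; have jP : 0 < j <= size P by rewrite sP.
apply/idP/idP => [oq|jl].
  have [_ _ jo] := block_start_mem k0 PD jP; apply: leq_trans jo _; exact: (head_queue k0 PD oq).
apply: (block_start_queue k0 PD (queue_head mn)) => //.
by rewrite -hd ltnW // (ltn_trans sf).
Qed.

Variable g : nat -> nat.
Hypothesis gF : final P g.
Let C := map (map g) (matching k P).

(** If the served step is not the head of the queue, the head goes on waiting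
    and the minimum is unchanged, by [reach_le]. *)
Lemma running_minE i : 0 < i <= n ->
  running_min (ylen k n C) i + last_end (n - i) = N.
Proof.
elim: i => // i IH /andP[_ lein].
have mn : n - i.+1 < n by lia.
have yE := ylenE k0 gF mn; rewrite (_ : n - (n - i.+1) = i.+1) -/C in yE; last by lia.
have le1 := reach_le mn; have le2 := last_end_le mn.
have sq := served_mem k0 PD mn; have hq := queue_head mn.
case: i IH lein mn yE le1 le2 sq hq => [|i] IH lein mn yE le1 le2 sq hq.
  rewrite /= -reach_head //.
  have := size_queue k0 PD (ltnW mn); rewrite (_ : n - (n - 1) = 1); last by lia.
  by case: (queue _) sq => [|a [|]] //= ; rewrite inE => /eqP.
rewrite -[running_min _ _]/(minn (running_min (ylen k n C) i.+1) (ylen k n C i.+2)).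
have {}IH := IH (ltnW lein); set m := n - i.+2 in mn yE le1 le2 sq hq *.
have mS : n - i.+1 = m.+1 by rewrite /m; lia.
rewrite mS in IH; have mSn : m.+1 < n by rewrite /m; lia.
have lm := last_end_mono mSn; have lS := last_end_le mSn.
case: (eqVneq (served m) (head 0 (queue m))) => [hd|nhd].
  by have := reach_head mn hd; lia.
have : last_end m <= last_end m.+1.
  by apply: (head_queue k0 PD); rewrite mem_queueS eq_sym nhd.
by lia.
Qed.

End Rows.

(** The boxes above a path determine the height at which it crosses each
    antidiagonal. *)
Lemma kdyck_eq k n (p q : kdyck k n) :
  (forall y, y < n -> row_len p y = row_len q y) -> p = q.
Proof.
move=> h; apply/val_inj/val_inj => /=.
have [sp _ _] := steps_dyck p; have [sq _ _] := steps_dyck q.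
have H v m : m < v -> m < n -> (ups p v <= m) = (ups q v <= m).
  move=> mv mn; have e : above p (box_at v m) = above q (box_at v m).
    by rewrite /above /= h.
  by move: e; rewrite !above_kdyck corner_box_at // /= mn.
have un (r : kdyck k n) v : ups r v <= n.
  rewrite -[X in _ <= X](kdyck_count r) /ups -{2}(cat_take_drop v r) count_cat.
  exact: leq_addr.
apply: ups_inj => [|v _]; first by rewrite sp sq.
have lt (r s : kdyck k n) : (forall m, m < v -> m < n -> (ups r v <= m) = (ups s v <= m)) ->
    ups s v <= ups r v.
  move=> hrs; rewrite leqNgt; apply/negP => c.
  have := hrs (ups r v) (leq_trans c (ups_le _ _)) (leq_trans c (un _ _)).
  by rewrite leqnn leqNgt c.
apply/eqP; rewrite eqn_leq !lt // => m mv mn; rewrite H //.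
Qed.

Theorem RSKinv_graphP k n (P Q : kdyck k n) : 0 < k -> 0 < n ->
  RSKinv_graph P Q <->
  forall y, y < n -> row_len Q y = k.+1 * n - last_end P y.
Proof.
move=> k0 n0; have [D [g [ex gF tD sD]]] := slides_exist P k0 (matching k P) n0.
have rE i (C := map (map g) (matching k P)) : 0 < i <= n ->
    ymax k n C i = k.+1 * n - last_end P (n - i).
  by move=> iN; rewrite /ymax /C; have := running_minE k0 gF iN; lia.
split=> [[D' [C' [mD' ex' rQ]]] y yn|rQ].
  have DD' := max_tiling_unique k0 tD sD mD'.
  have uni E : is_tiling P E -> uniq E.
    case=> _ + _; elim: E => // t E IH.
    have -> : flatten (map tile_boxes (t :: E)) = tile_boxes t ++ flatten (map tile_boxes E).
      by [].
    rewrite cat_uniq => /and3P[_ /hasPn h /IH uE].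
    apply/andP; split=> //; apply/negP => tE.
    have bt : box_at (first_corner t) (row_at t (first_corner t)) \in tile_boxes t.
      by apply: tile_box; rewrite leqnn leq_addr.
    suff : box_at (first_corner t) (row_at t (first_corner t)) \in flatten (map tile_boxes E).
      by move/h; rewrite bt.
    by apply/flattenP; exists (tile_boxes t) => //; apply: map_f.
  have [[tD' _] _] := mD'.
  have pe : perm_eq D D' by apply: uniq_perm => //; apply: uni.
  have CE : C' = map (map g) (matching k P).
    rewrite (exchange_allE ex') (exchange_allE ex); apply/esym/exchange_all_perm => //.
      exact: exchange_order ex.
    exact: exchange_order ex'.
  have := rQ (n - y); rewrite CE rE; last by lia.
  by rewrite (_ : n - (n - y) = y); [apply; lia|lia].
exists D, (map (map g) (matching k P)); split=> //; first exact: slides_max.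
by move=> i iN; rewrite rE ?rQ //; lia.
Qed.

Lemma RSKinv_exists k n (P : kdyck k n) : 0 < k -> 0 < n ->
  {Q : kdyck k n | forall y, y < n -> row_len Q y = k.+1 * n - last_end P y}.
Proof.
move=> k0 n0; pose r y := k.+1 * n - last_end P y.
have [|||Q rQ] := @kdyck_of_rows k n (mkseq r n); first by rewrite size_mkseq.
- apply/(sortedP 0) => i; rewrite size_mkseq => hi; rewrite !nth_mkseq // ?(ltnW hi) //.
  by have := last_end_mono P k0 hi; rewrite /r; lia.
- move=> y yn; rewrite nth_mkseq //.
  have [D [g [ex gF tD sD]]] := slides_exist P k0 (matching k P) n0.
  have yN : 0 < n - y <= n by lia.
  have := running_minE k0 gF yN; rewrite (_ : n - (n - y) = y); last by lia.
  set C := map _ _ => E; rewrite /r -E addnK.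
  apply: (@leq_trans (ylen k n C (n - y))).
    by case: (n - y) yN => // -[|i] _ //; exact: geq_minr.
  by rewrite /ylen (leq_trans (leq_subr _ _)) // mulnC leq_mul2l; lia.
by exists Q => y yn; rewrite /row_len rQ nth_mkseq.
Qed.

(** * Promotion of words *)

Lemma ups_cat X Y i : ups (X ++ Y) i = ups X i + ups Y (i - size X).
Proof.
rewrite /ups take_cat; case: ltnP => h; last by rewrite count_cat (take_oversize h).
by rewrite (_ : i - size X = 0) ?take0 /= ?addn0 //; apply/eqP; rewrite subn_eq0 ltnW.
Qed.

Lemma ups_cons a w i : ups (a :: w) i.+1 = a + ups w i.
Proof. by []. Qed.

Lemma ups_swap X a b Z i : i != (size X).+1 ->
  ups (X ++ a :: b :: Z) i = ups (X ++ b :: a :: Z) i.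
Proof.
move=> ni; rewrite !ups_cat; congr (_ + _).
case E : (i - size X) => [|[|j]]; rewrite ?ups0 //; first by lia.
by rewrite /ups /= addnCA.
Qed.

(** The two paths differ at a single vertex. *)
Lemma dyck_swap k n X a b Z : is_kdyck k n (X ++ a :: b :: Z) ->
  is_kdyck k n (X ++ b :: a :: Z) = ((size X).+1 <= k.+1 * (count id X + b)).
Proof.
move=> /dyckP[s1 h1 D1].
have ss : size (X ++ b :: a :: Z) = size (X ++ a :: b :: Z) by rewrite !size_cat.
have uS : ups (X ++ b :: a :: Z) (size X).+1 = count id X + b.
  by rewrite ups_cat subSnn (upsS _ 0) ups0 add0n {1}/ups take_oversize.
apply/dyckP/idP => [[s2 h2 D2]|h].
  by rewrite -uS; apply: D2; rewrite size_cat /=; lia.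
split; first by rewrite ss.
  by rewrite -h1 ss -ups_swap //; rewrite size_cat /=; lia.
move=> i; rewrite ss => hi; case: (eqVneq i (size X).+1) => [->|ni]; first by rewrite uS.
by rewrite -ups_swap //; apply: D1.
Qed.

Lemma letter_cat X Y i : 0 < i ->
  letter (X ++ Y) i = if i <= size X then letter X i else letter Y (i - size X).
Proof. by case: i => // i _; rewrite /letter /= nth_cat; case: ltnP => // h; rewrite subSn. Qed.

Lemma swap_word k n (p : kdyck k n) X a b Z : p = X ++ a :: b :: Z :> bitseq ->
  swap_steps (size X).+1 p = X ++ b :: a :: Z :> bitseq.
Proof.
move=> pE; have sz : size (X ++ a :: b :: Z) = k.+1 * n by rewrite -pE size_tuple.
apply: (@eq_from_nth _ false); first by rewrite size_tuple -sz !size_cat.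
move=> i; rewrite size_tuple => iN.
rewrite -[LHS](tnth_nth false (swap_steps _ _) (Ordinal iN)) tnth_mktuple /= pE.
rewrite -[RHS]/(letter _ i.+1) !letter_cat //; last by rewrite /transp; repeat case: eqP.
rewrite /transp; case: eqP => [->|n1].
  by rewrite ltnNge leqnSn ltnn subSnn (_ : _ - _ = 2) //; lia.
case: eqP => [->|n2]; first by rewrite ltnn (_ : (size X).+2 <= size X = false) ?subSnn 1?(_ : (size X).+2 - size X = 2) //; lia.
case: ltnP => // h; have -> : i.+1 - size X = (i - (size X).+2).+3 by lia.
by [].
Qed.

Lemma toggle_word k n (p : kdyck k n) X a b Z : p = X ++ a :: b :: Z :> bitseq ->
  toggle (size X).+1 p =
    (if (size X).+1 <= k.+1 * (count id X + b) then X ++ b :: a :: Z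
     else X ++ a :: b :: Z) :> bitseq.
Proof.
move=> pE; have pD : is_kdyck k n (X ++ a :: b :: Z) by rewrite -pE; exact: (valP p).
rewrite -(dyck_swap pD) /toggle val_insubd (swap_word pE).
by case: ifP => _; [exact: swap_word|].
Qed.

(** The toggles carry an up step to the right as long as the prefixes without
    it stay above the line. *)
Lemma slide_up k n X A T (p : kdyck k n) : p = X ++ true :: A ++ T :> bitseq ->
  (forall j, j < size A -> size X + j.+1 <= k.+1 * (count id X + ups A j.+1)) ->
  foldl (fun q i => toggle i q) p (iota (size X).+1 (size A)) = X ++ A ++ true :: T :> bitseq.
Proof.
elim: A X p => [|a A IH] X p pE hA; first exact: pE.
have tE := toggle_word pE; rewrite ifT in tE; last first.
  by have := hA 0 isT; rewrite addn1 /ups /= take0 addn0.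
have := IH (rcons X a) (toggle (size X).+1 p); rewrite size_rcons /= => -> //.
- by rewrite cat_rcons.
- by rewrite tE cat_rcons.
move=> j hj; have := hA j.+1 hj; rewrite -cats1 count_cat /= addn0 /ups /=; lia.
Qed.

(** Exchanging a right step with the next letter never leaves the set of
    k-Dyck paths, so the toggles carry the right step to the end. *)
Lemma slide_right k n X B (p : kdyck k n) : p = X ++ false :: B :> bitseq ->
  foldl (fun q i => toggle i q) p (iota (size X).+1 (size B)) = X ++ rcons B false :> bitseq.
Proof.
elim: B X p => [|b B IH] X p pE; first exact: pE.
have tE := toggle_word pE; rewrite ifT in tE; last first.
  have [_ _ D] := steps_dyck p; rewrite pE in D.
  have := D (size X).+1; rewrite size_cat /= -addSnnS leq_addr => /(_ isT) h.
  apply: leq_trans h _; rewrite leq_mul2l; apply/orP; right.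
  by rewrite ups_cat subSnn (upsS _ 0) ups0 {1}/ups take_oversize // addn0 leq_addr.
have := IH (rcons X b) (toggle (size X).+1 p); rewrite size_rcons /= => -> //.
- by rewrite cat_rcons.
- by rewrite tE cat_rcons.
Qed.

(** The factor [A] ends just before the first right step of the block of the
    first up step.  The toggles carry this up step through [A]; the toggle at
    the right step would leave the k-Dyck paths, and from there on the right
    step is carried to the end. *)
Lemma promotion_word k n (Y : kdyck k n) : 0 < k -> 0 < n -> exists A B,
  [/\ Y = true :: A ++ false :: B :> bitseq,
      promotion Y = A ++ true :: rcons B false :> bitseq
    & size A = k.+1 * count id A].
Proof.
move=> k0 n0; have [sY uY DY] := steps_dyck Y.
have N2 : 1 < k.+1 * n by nia.
have [Y' YE] : exists Y', Y = true :: Y' :> bitseq.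
  have := DY 1; case: (tval _) sY => [/=|[] Y' _]; [lia| |]; first by exists Y'.
  by rewrite /ups /= take0 /= muln0 => /(_ isT).
rewrite YE /= in sY uY.
have uY' : ups Y' (size Y') = n.-1 by move: uY; rewrite /ups /=; lia.
have Pend : size Y' < (size Y').+1 by [].
have bad : ~~ (size Y' <= k.+1 * ups Y' (size Y')) by rewrite uY'; nia.
have := @find_iota (fun j => ~~ (j <= k.+1 * ups Y' j)) _ _ Pend bad.
move: (find _ _) => j [hj jY nj].
have {}nj i : i < j -> i <= k.+1 * ups Y' i by move=> ij; have := nj i ij; rewrite negbK.
case: j hj jY nj => [|j] hj jY nj; first by rewrite ups0 in hj.
have hj' := nj j (ltnSn j).
have Lj : letter Y' j.+1 = false.
  by apply/negbTE/negP => L; move: hj; rewrite upsS L; nia.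
have ej : j = k.+1 * ups Y' j by move: hj; rewrite upsS Lj; lia.
pose A := take j Y'; pose B := drop j.+1 Y'.
have Y'E : Y' = A ++ false :: B.
  rewrite -{1}(cat_take_drop j Y') (drop_nth false) //; congr (_ ++ _ :: _).
  exact: Lj.
have sA : size A = j by rewrite size_takel // ltnW.
have YE' : Y = true :: A ++ false :: B :> bitseq by rewrite YE -Y'E.
exists A, B; split=> //; last by rewrite sA.
have sN : (k.+1 * n).-1 = size A + (1 + size B) by rewrite -sY Y'E size_cat /= add1n.
rewrite /promotion sN iotaD foldl_cat iotaD foldl_cat /=.
have e1 := @slide_up k n [::] A (false :: B) Y YE'.
rewrite /= in e1; have {}e1 := e1 _.
set Y1 := foldl _ Y _ in e1 *.
have {}e1 : Y1 = A ++ true :: false :: B :> bitseq.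
  apply: e1 => i; rewrite sA => hi; have := nj i.+1 hi.
  by rewrite !add0n /A /ups take_takel.
have e2 := toggle_word e1; rewrite sA in e2.
have cA : count id A = ups Y' j by [].
rewrite ifF in e2; last by apply/negbTE; rewrite -ltnNge cA addn0 -ej.
have e3 : toggle j.+1 Y1 = rcons A true ++ false :: B :> bitseq by rewrite e2 cat_rcons.
have := slide_right e3; by rewrite size_rcons sA cat_rcons add1n addn1.
Qed.

Section Shift.

Variables (k n : nat) (Y : kdyck k n).
Hypothesis k0 : 0 < k.
Hypothesis n0 : 0 < n.
Local Notation N := (k.+1 * n).
Local Notation Q := (promotion Y).

(** The same description by counting: [s] is the length of [A], after which
    stands the up step that has been carried along. *)
Lemma promotion_ups : exists s, [/\ k.+1 * ups Q s = s, s.+1 < N, is_up Q s.+1,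
    forall i, i < N -> ups Y i.+1 = ups Q i + (i <= s)
  & forall u, is_up Y u.+2 = is_up Q u.+1 && (u != s)].
Proof.
have [A [B [YE QE sA]]] := promotion_word Y k0 n0; exists (size A).
have sN : (size A + size B).+2 = N by rewrite -(size_tuple Y) YE /= size_cat /= addnS.
have u1 i : i < N -> ups Y i.+1 = ups Q i + (i <= size A).
  move=> iN; rewrite YE QE ups_cons !ups_cat addnC -!addnA; congr (_ + _).
  case: (leqP i (size A)) => h; first by rewrite (_ : i - size A = 0) ?ups0 //; apply/eqP; rewrite subn_eq0.
  have [j ->] : exists j, i = size A + j.+1 by exists (i - (size A).+1); lia.
  rewrite addKn !ups_cons -cats1 ups_cat addn1 addn0 add0n add1n.
  by case: (j - size B) => [|m]; rewrite ?ups0 ?addn0 // /ups /= addn0.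
have uA : ups Q (size A) = count id A.
  by rewrite QE ups_cat subnn ups0 addn0 /ups take_size.
have UQ : is_up Q (size A).+1.
  by rewrite /is_up /= QE letter_cat // ltnn subSnn.
split=> //; [by rewrite uA|by rewrite -sN !ltnS leq_addr|].
move=> u; case: (ltnP u.+1 N) => uN.
  have := u1 u.+1 uN; rewrite (upsS Y u.+1) (upsS Q u) (u1 u (ltnW uN)) /is_up /=.
  move: UQ; rewrite /is_up /=; case: (eqVneq u (size A)) => [->|nu] LQ.
    by rewrite LQ leqnn ltnn andbF; case: (letter _ _) => //; lia.
  by rewrite andbT; move: nu; case: (letter Y _); case: (letter Q _) => //; lia.
have sY : size Y = N by rewrite size_tuple.
rewrite {1}/is_up letter_default ?sY //=; apply/esym/negbTE; rewrite negb_and.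
apply/orP; left; apply/negP => Uu; have [f1 f2 _ _] := block_endP k0 (steps_dyck Q) Uu.
by rewrite size_tuple in f2; lia.
Qed.

End Shift.

(** * Promotion and the queue *)

(** The last letter of a path belongs to some block. *)
Lemma last_end0 k n (P : kdyck k n) : 0 < k -> 0 < n -> last_end P 0 = k.+1 * n.
Proof.
move=> k0 n0; have PD := steps_dyck P; have sP := size_tuple (steps P).
have NP : 0 < k.+1 * n <= size P by rewrite sP; nia.
have [oU _ No] := block_start_mem k0 PD NP; apply/eqP; rewrite eqn_leq last_end_le //=.
by apply: leq_trans No _; apply: (head_queue k0 PD); rewrite mem_queue0.
Qed.

Lemma rem_map_S x s : rem x.+1 (map S s) = map S (rem x s).
Proof. by elim: s => //= a s IH; rewrite eqSS; case: eqP => //= _; rewrite IH. Qed.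

(** Serving commutes with the removal of the head, up to the shift: either the
    same step of the tail is chosen on both sides, or the head of [T] on one
    side and the head of its tail on the other. *)
Lemma chosen_shift T y : uniq T ->
  rem (chosen (map S (behead T)) y.+1) (map S (behead T)) =
  map S (behead (rem (chosen T y) T)).
Proof.
case: T => [//|t T] /= /andP[tT uT]; rewrite {1}/chosen mem_map; last exact: succn_inj.
case: (boolP (y.+1 \in T)) => yT.
  rewrite /chosen inE yT orbT rem_map_S.
  by case: eqP => // ty; rewrite ty yT in tT.
have -> : chosen (t :: T) y = t.
  by rewrite /chosen inE (negbTE yT) orbF; case: eqP.
rewrite eqxx; case: T {tT uT yT} => //= a T; by rewrite eqxx.
Qed.

Section Shift.

Variables (k n : nat) (Y : kdyck k n).
Hypothesis k0 : 0 < k.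
Hypothesis n0 : 0 < n.
Local Notation N := (k.+1 * n).
Local Notation Q := (promotion Y).
Let YD := steps_dyck Y.
Let QD := steps_dyck Q.

(** The spans keep their length and move by one position, except that of the
    first up step: its block becomes the block of [r], the last one of the
    rotated path to end. *)
Lemma promotion_spans : exists r, [/\ is_up Q r, block_end k Q r = N,
  is_up Y 1,
  forall u, is_up Y u.+1 = (u == 0) || is_up Q u && (u != r)
& forall u, is_up Q u -> u != r -> block_end k Y u.+1 = (block_end k Q u).+1].
Proof.
have [s [hs sN Us u1 upY]] := promotion_ups Y k0 n0.
have [sY _ hY] := YD; have [sQ eQ hQ] := QD; rewrite sY in hY; rewrite sQ in eQ hQ.
have fs : block_end k Q s.+1 = N.
  apply: (block_end_unique k0 QD Us); rewrite ?sQ //=; first exact: ltnW.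
    by rewrite eQ hs addnC.
  move=> i si iN; rewrite hs addnC ltn_add2l; have := hY i.+1 iN; rewrite u1 //.
  by rewrite [i <= s]leqNgt si addn0.
exists s.+1; split=> //.
- have N0 : 0 < N by lia.
  by have := u1 0 N0; rewrite upsS !ups0 /is_up /=; case: (letter Y 1).
- have Y1 : is_up Y 1.
    have N0 : 0 < N by lia.
    by have := u1 0 N0; rewrite upsS !ups0 /is_up /=; case: (letter Y 1).
  by case=> [|u]; [rewrite Y1|rewrite upY eqSS].
move=> u Uu us; have u0 : 0 < u by case/andP: Uu.
have [f1 f2 f3 f4] := block_endP k0 QD Uu; rewrite sQ in f2.
have fN : block_end k Q u < N.
  rewrite ltn_neqAle f2 andbT; apply: contraNneq us => E; apply/eqP.
  by apply: (block_end_inj k0 QD Uu Us); rewrite fs.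
have UY : is_up Y u.+1.
  by case: u u0 Uu us {f1 f2 f3 f4 fN} => // u _ Uu us; rewrite upY Uu.
have lin i : u.-1 <= i -> i <= block_end k Q u ->
    ups Y i.+1 + ups Q u.-1 = ups Y u + ups Q i.
  move=> ui ie; have iN : i < N by apply: leq_ltn_trans fN.
  have uN : u.-1 < N by apply: leq_ltn_trans iN.
  have := u1 i iN; have := u1 u.-1 uN; rewrite prednK // => -> ->.
  suff -> : (i <= s) = (u.-1 <= s) by lia.
  case: (leqP i s) => [is_|si]; first by rewrite (leq_trans ui is_).
  apply/esym/negbTE; rewrite -ltnNge.
  case: (ltngtP u s.+1) us => // [us _|us _]; last by lia.
  have fe : s < block_end k Q u by lia.
  have := f4 s us fe; rewrite hs; have := hQ u.-1 (ltnW uN); lia.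
apply: (block_end_unique k0 YD UY); rewrite ?sY //=; first exact: ltnW.
  have := lin (block_end k Q u); have := lin u.-1; rewrite prednK //.
  by move=> h1 h2; have := h2 ltac:(lia) (leqnn _); nia.
case=> // i; rewrite !ltnS => ui ie; have := f4 i ui ie; have := lin i.
by move=> h1 h2; have := h1 ltac:(lia) (ltnW ie); nia.
Qed.

(** At time [1] the first up step of [Y] has been served, where it stands; its
    counterpart in [promotion Y] has the last block end and is the head of the
    queue at time [0].  From then on both queues evolve in the same way. *)
Lemma queue_shift y : y < n -> queue k Y y.+1 = map S (behead (queue k Q y)) /\
  forall u, u \in behead (queue k Q y) -> block_end k Y u.+1 = (block_end k Q u).+1.
Proof.
have [r [Ur fr Y1 upY fS]] := promotion_spans.
have nr j u : u \in behead (queue k Q j) -> is_up Q u /\ u != r.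
  move=> uq; have uq' := mem_behead uq; have Uu := queue_up uq'; split=> //.
  apply: contraTneq uq => ->; have := queue_sorted k0 QD j; have := @queue_up k Q j.
  case: (queue k Q j) => //= a s upq; rewrite (path_sortedE (@later_trans k Q)) => /andP[/allP h _].
  apply/negP => /h; rewrite /later fr ltnNge.
  have Ua : is_up Q a by apply: upq; rewrite mem_head.
  by have [_ f2 _ _] := block_endP k0 QD Ua; rewrite size_tuple in f2; rewrite f2.
move=> yn; split; last by move=> u /nr [Uu ur]; apply: fS.
elim: y yn => [|y IH] yn; last first.
  rewrite queueS /served (IH (ltnW yn)) chosen_shift ?uniq_queue //.
have s0 : served k Y 0 = 1 by rewrite /served /chosen mem_queue0 Y1.
apply: (irr_sorted_eq (@later_trans k Y)); first by move=> u; rewrite /later ltnn.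
- exact: (queue_sorted k0 YD).
- rewrite sorted_map.
  have : sorted (later k Q) (behead (queue k Q 0)).
    rewrite -drop1.
    exact: (subseq_sorted (@later_trans k Q) (drop_subseq _ 1) (queue_sorted k0 QD 0)).
  apply: sub_in_sorted; last exact: allss.
  by move=> u v /nr [Uu ur] /nr [Uv vr]; rewrite /later /= !fS.
have hr : head 0 (queue k Q 0) = r.
  have hU := queue_up (queue_head Q k0 n0).
  apply: (block_end_inj k0 QD) => //; rewrite fr; exact: last_end0.
move=> [|u]; rewrite mem_queueS s0 mem_queue0.
  by apply/esym/mapP => -[].
rewrite mem_map; last exact: succn_inj.
rewrite upY eqSS; case: (eqVneq u 0) => [->|_] /=.
  by apply/esym/negbTE/negP => /nr [/andP[]].
have := mem_queue0 k Q u; have := uniq_queue k Q 0; move: hr.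
case: (queue k Q 0) (queue_head Q k0 n0) => //= a s _ -> /andP[rs _] <-.
by rewrite inE; case: (eqVneq u r) => [->|] //=; rewrite ?andbF ?andbT // (negbTE rs).
Qed.

End Shift.

(** * The recursion for the rows, and rowmotion *)

Section Local.

Variables (k n : nat) (Y : kdyck k n).
Hypothesis k0 : 0 < k.
Hypothesis n0 : 0 < n.
Local Notation N := (k.+1 * n).
Local Notation Q := (promotion Y).
Let YD := steps_dyck Y.
Let QD := steps_dyck Q.
Local Notation T := (queue k Q).
Local Notation E := (last_end Q).

Lemma end_shift y : y.+1 < n -> last_end Y y.+1 = (block_end k Q (nth 0 (T y) 1)).+1.
Proof.
move=> yn; have [qE fE] := queue_shift Y k0 n0 (ltnW yn).
rewrite /last_end qE; have sz := size_queue k0 QD (ltnW (ltnW yn)).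
case: (T y) sz fE => [|t [|t1 T']] /= sz fE; try by lia.
by rewrite fE ?mem_head.
Qed.

(** Let [t], [t1] be the first two steps of the queue at time [z].  If [t] is
    served, [t1] becomes the head, and the end of [t1] is, up to the shift,
    also the value for [Y].  Otherwise [z+1] is served and [t] stays in front;
    [t1] stays second too unless it is [z+1] itself, and then the span of
    [z+1] contains exactly the waiting steps other than [t], which gives its
    end. *)
Lemma local_rule z : z.+1 < n ->
  (E z.+1 < E z /\ last_end Y z.+1 = (E z.+1).+1) \/
  (E z.+1 = E z /\ ((z.+2 < n /\ last_end Y z.+2 = last_end Y z.+1) \/
                    N = last_end Y z.+1 + k * z.+1)).
Proof.
move=> zn; rewrite (end_shift zn).
have sz := size_queue k0 QD (ltnW (ltnW zn)).
have qS := queueS k Q z; have st := queue_sorted k0 QD z; have uq := uniq_queue k Q z.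
have gt := @queue_gt k Q z; have up := @queue_up k Q z.
have gr u v := @greedy k Q n k0 QD z u v.
have sv : served k Q z = if z.+1 \in T z then z.+1 else head 0 (T z) by [].
have es z' : z'.+1 < n -> last_end Y z'.+1 = (block_end k Q (nth 0 (T z') 1)).+1 by exact: end_shift.
rewrite /(last_end Q z) /(last_end Q z.+1) qS {}sv.
have {}es : z.+2 < n -> last_end Y z.+2 = (block_end k Q (nth 0 (T z.+1) 1)).+1 by exact: es.
rewrite {}qS in es.
move: sz es st uq gt up gr; rewrite /served /chosen; move: (T z) => s.
case: s => [|t [|t1 s]] sz es st uq gt up gr; try by move: sz => /=; lia.
have /= /andP[ltt1 pt1] := st.
case: ifP es => zs es; last by left; rewrite /= eqxx.
case: (eqVneq z.+1 t) es => [zt|nzt] es; first by left.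
right; split; first by [].
case: (eqVneq z.+1 t1) => [zt1|nzt1].
  right; rewrite /= -zt1; rewrite -zt1 in ltt1.
  have Uz : is_up Q z.+1 by apply: up.
  have [f1 f2 f3 f4] := block_endP k0 QD Uz.
  have ft : block_end k Q z.+1 < block_end k Q t by [].
  (* The up steps in the span of [z+1] are the waiting ones other than [t]. *)
  have cnt : ups Q (block_end k Q z.+1) - ups Q z = n - z.+1.
    have -> : n - z.+1 = size (t1 :: s) by move: sz => /=; lia.
    rewrite -!count_upsteps.
    have := count_predUI (fun u => z < u <= block_end k Q z.+1) (fun u => u <= z) (upsteps Q).
    rewrite [X in _ + X = _](@eq_count _ _ pred0) ?count_pred0 => [|u] /=; last by lia.
    rewrite (@eq_count _ (predU _ _) (fun u => u <= block_end k Q z.+1)) => [|u] /=; last by lia.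
    rewrite addn0 => ->; rewrite addnK -size_filter.
    rewrite -[RHS]/(size (t1 :: s)); apply/perm_size/uniq_perm; first by rewrite filter_uniq ?uniq_upsteps.
      by case/andP: uq.
    move=> u; rewrite (mem_filter _ _ (upsteps Q)) mem_upsteps.
    apply/idP/idP => [/andP[/andP[zu ue] Uu]|us1].
      have fu := block_end_nest k0 QD Uz Uu zu ue.
      have : u \in [:: t, t1 & s].
        by case: (boolP (u \in _)) => // nu; have := gr u z.+1 Uu zu nu zs; rewrite ltnNge fu.
      by rewrite inE => /predU1P[ut|//]; move: fu; rewrite ut leqNgt ft.
    have us2 : u \in [:: t, t1 & s] by rewrite inE us1 orbT.
    have Uu := up u us2; rewrite Uu andbT (gt u us2) /=.
    have [g1 _ _ _] := block_endP k0 QD Uu; apply: leq_trans (ltnW g1) _.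
    move: us1; rewrite inE zt1 => /predU1P[->//|]; move: pt1.
    by rewrite (path_sortedE (@later_trans k Q)) => /andP[/allP h _] /h /ltnW.
  have um := @ups_mono Q z (block_end k Q z.+1); rewrite /= in f3.
  by move: cnt f3 um zn f1; clear; nia.
left; have t1s : z.+1 \in s.
  by move: zs; rewrite !inE (negbTE nzt) (negbTE nzt1).
have zn2 : z.+2 < n by move: sz t1s => /=; case: (s) => //= a s' ; lia.
by split=> //; rewrite es //= (eq_sym t) (negbTE nzt) /= (eq_sym t1) (negbTE nzt1).
Qed.

End Local.

Section Rowmotion.

Variables (k n : nat).
Implicit Types p q : kdyck k n.

Lemma row_len_le p y : y < n -> row_len p y <= k * y.
Proof.
move=> yn; rewrite leqNgt; apply/negP => c.
have : above p (k * y, y) by exact: c.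
rewrite above_kdyck yn /corner /=; have [s e D] := steps_dyck p.
have vN : (k * y + y).+1 <= size p by rewrite s; nia.
by have := D _ vN; nia.
Qed.

Lemma row_len_mono p a b : a <= b -> b < n -> row_len p a <= row_len p b.
Proof.
move=> ab; rewrite -(subnKC ab); elim: (b - a) => [|d IH]; first by rewrite addn0.
rewrite addnS => yn; apply: leq_trans (IH (ltnW yn)) _; move: (a + d) yn => y yn.
rewrite leqNgt; apply/negP => c.
have : above p (row_len p y.+1, y) by exact: c.
move/(@above_up k n p _ (row_len p y.+1, y.+1)) => /(_ yn).
by rewrite /box_le /= leqnn leqnSn /above /= ltnn => /(_ isT).
Qed.

Lemma is_rowmotion_unique p q q' : is_rowmotion p q -> is_rowmotion p q' -> q = q'.
Proof.
move=> /allP h /allP h'; apply: kdyck_eq => y yn.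
have e x : (x < row_len q y) = (x < row_len q' y).
  case: (ltnP x (k * y)) => xk; last first.
    by rewrite !ltnNge !(leq_trans (row_len_le _ yn) xk).
  have xb : (x, y) \in boxes k n by rewrite mem_boxes yn xk.
  have := h _ xb; have := h' _ xb; rewrite ![_ \in order_filter _]mem_filter xb !andbT.
  by rewrite /above /= => /eqP -> /eqP ->.
by apply/eqP; rewrite eqn_leq leqNgt e ltnn /= leqNgt -e ltnn.
Qed.

(** The row [y] of the region above [p] is longer than the one below it, so
    that its last box is a minimal element of the filter. *)
Definition jump p y := (0 < y) && (row_len p y.-1 < row_len p y).

Lemma mem_minimals p c : (c \in minimals (order_filter p)) =
  [&& c.2 < n, jump p c.2 & c.1.+1 == row_len p c.2].
Proof.
have inF b : (b \in order_filter p) = (b.2 < n) && (b.1 < row_len p b.2).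
  rewrite mem_filter mem_boxes /above; case: (ltnP b.2 n) => bn /=; last by rewrite andbF.
  by case: ltnP => //= h; rewrite (leq_trans h (row_len_le p bn)).
rewrite mem_filter inF; case: c => x y /=; case: (ltnP y n) => yn /=; last by rewrite andbF.
have r0 : row_len p 0 = 0 by apply/eqP; have := @row_len_le p 0; rewrite muln0 leqn0 => ->; lia.
apply/andP/andP => [[/allP h xr]|[/andP[y0 jp] /eqP xr]].
  have y0 : 0 < y by case: y yn h xr => //; rewrite r0.
  have xE : x.+1 == row_len p y.
    rewrite eqn_leq xr leqNgt; apply/negP => c.
    have := h (x.+1, y); rewrite inF yn c /box_le /= leqnSn leqnn /= => /(_ isT).
    by rewrite xpair_eqE eqn_leq ltnn.
  split=> //; rewrite /jump y0 /= -(eqP xE) ltnS leqNgt; apply/negP => c.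
  have := h (x, y.-1); rewrite inF (leq_ltn_trans (leq_pred _) yn) c /box_le /= leqnn leq_pred.
  by move=> /(_ isT) /eqP[]; lia.
split; last by rewrite -xr.
apply/allP => -[x' y']; rewrite inF /box_le /= => /andP[y'n x'r].
apply/implyP => /andP[xx' yy']; rewrite xpair_eqE.
case: (ltngtP y' y) yy' => // [lt _|E _].
  have h1 : y' <= y.-1 by lia.
  have := row_len_mono p h1; lia.
by move: x'r; rewrite andbT E; lia.
Qed.

(** Downward induction on the row: the boxes of the row [y] in the ideal are
    those below the minimal box of this row, if it has one, and otherwise
    those below a minimal box of a higher row. *)
Lemma is_rowmotion_rows p q :
  (forall y, y < n -> jump p y -> (row_len q y).+1 = row_len p y) ->
  (forall y, y < n -> ~~ jump p y ->
     (y.+1 < n /\ row_len q y = row_len q y.+1) \/ row_len q y = k * y) ->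
  is_rowmotion p q.
Proof.
move=> hj hn; apply/allP => b bb; have := bb; rewrite mem_boxes => /andP[yn xk].
rewrite [_ \in order_filter q]mem_filter bb andbT [_ \in ideal _ _ _]mem_filter bb andbT.
case: b bb yn xk => x y /= _ yn xk; rewrite /above /=.
apply/eqP; apply: (canRL negbK); rewrite -leqNgt.
have [m le] := ubnP (n - y); elim: m y le yn xk => // m IH y le yn xk.
case: (boolP (jump p y)) => jy.
  have E := hj y yn jy; apply/idP/hasP => [rx|[[x' y']]].
    exists (row_len q y, y); first by rewrite mem_minimals /= yn jy E eqxx.
    by rewrite /box_le /= rx leqnn.
  rewrite mem_minimals /box_le /= => /and3P[y'n _ /eqP x'E] /andP[xx yy].
  by have := row_len_mono p yy y'n; lia.
case: (hn y yn jy) => [[y1 ->]|E].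
  rewrite IH //; try by nia.
  apply/hasP/hasP => -[[x' y'] mc]; rewrite /box_le /= => /andP[xx yy];
    exists (x', y') => //=; rewrite xx /=; first by rewrite ltnW.
  rewrite ltn_neqAle yy andbT; apply: contraNneq jy => ->.
  by move: mc; rewrite mem_minimals => /and3P[].
rewrite E leqNgt xk; apply/esym/hasP => -[[x' y']]; rewrite mem_minimals /box_le /=.
case/and3P=> y'n jy' /eqP x'E /andP[xx yy].
by have := hj y' y'n jy'; have := row_len_mono q yy y'n; rewrite E; lia.
Qed.

End Rowmotion.

Lemma rowmotion_promotion k n (Y p q : kdyck k n) : 0 < k -> 0 < n ->
  (forall y, y < n -> row_len p y = k.+1 * n - last_end (promotion Y) y) ->
  (forall y, y < n -> row_len q y = k.+1 * n - last_end Y y) ->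
  rowmotion p = q.
Proof.
move=> k0 n0 pE qE; apply: is_rowmotion_unique (rowmotionP p) _.
have EQ y : y < n -> last_end (promotion Y) y <= k.+1 * n by move=> h; exact: last_end_le.
have EY y : y < n -> last_end Y y <= k.+1 * n by move=> h; exact: last_end_le.
have E0 := last_end0 Y k0 n0.
apply: is_rowmotion_rows => y yn; rewrite /jump.
  case: y yn => // z zn /=; rewrite !pE ?qE // ?(ltnW zn) //.
  have := local_rule Y k0 n0 zn; have := EQ z (ltnW zn); have := EQ _ zn; have := EY _ zn.
  by lia.
case: y yn => [_ _|z zn /=].
  by right; rewrite qE // E0 subnn muln0.
rewrite !pE // ?(ltnW zn) // => nj.
have := local_rule Y k0 n0 zn; have := EQ z (ltnW zn); have := EQ _ zn; have := EY _ zn.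
move=> h1 h2 h3 [|[_ [[zn2 e]|e]]]; first by lia.
  by left; rewrite !qE ?e.
by right; rewrite qE //; lia.
Qed.

(** * The ends of the blocks determine the path *)

Section Ends.

Variables (k n : nat) (w : bitseq).
Hypothesis k0 : 0 < k.
Hypothesis wD : dyck k n w.
Local Notation K := k.+1.
Local Notation N := (size w).
Local Notation block_end := (block_end k w).

Definition ends (i : nat) : nat := count (fun v => block_end v <= i) (upsteps w).

Definition open_at (i : nat) : nat := count (fun v => (v <= i) && (i < block_end v)) (upsteps w).

Lemma ends_open i : ends i + open_at i = ups w i.
Proof.
rewrite -count_upsteps /ends /open_at.
have := count_predUI (fun v => block_end v <= i) (fun v => (v <= i) && (i < block_end v)) (upsteps w).
rewrite [X in _ + X = _](@eq_count _ _ pred0) ?count_pred0 ?addn0 => [<-|v]; last first.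
  by rewrite /= leqNgt; case: (i < block_end v); rewrite ?andbF.
apply: eq_in_count => v; rewrite mem_upsteps => Uv /=; have [f1 _ _ _] := block_endP k0 wD Uv.
by lia.
Qed.

(** The same spans are open before and after the span of [u], so it contains
    as many ends of blocks as up steps. *)
Lemma ends_span u : is_up w u -> block_end u + K * ends u.-1 = u.-1 + K * ends (block_end u).
Proof.
move=> Uu; have [f1 f2 f3 f4] := block_endP k0 wD Uu; have u0 : 0 < u by case/andP: Uu.
suff oE : open_at (block_end u) = open_at u.-1.
  by move: f3; rewrite -!ends_open oE !mulnDr; lia.
apply: eq_in_count => v; rewrite mem_upsteps => Uv; have [g1 g2 _ _] := block_endP k0 wD Uv.
apply/andP/andP => -[h1 h2].
  case: (leqP u v) => uv; first by have := block_end_nest k0 wD Uu Uv uv h1; lia.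
  by split; lia.
have vu : v <= u by lia.
have uf : u <= block_end v by lia.
have := block_end_nest k0 wD Uv Uu vu uf.
case: (ltngtP (block_end u) (block_end v)) => // [_|E _]; first by split; lia.
by have := block_end_inj k0 wD Uu Uv E; lia.
Qed.

(** Each block that ends in the stretch lies in it entirely, with its [k+1]
    letters. *)
Lemma ends_free a i : a <= i ->
  (forall v, is_up w v -> v <= a -> a < block_end v -> i < block_end v) ->
  K * ends i + a <= K * ends a + i.
Proof.
elim/ltn_ind: i => i IH ai cr; case: (ltngtP a i) ai => // [ai _|-> _]; last by rewrite addnC.
case: (boolP (has (fun v => block_end v == i) (upsteps w))) => [/hasP[v]|/hasPn nov].
  rewrite mem_upsteps => Uv /eqP vi; have [f1 f2 f3 f4] := block_endP k0 wD Uv.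
  have av : a < v by rewrite ltnNge; apply/negP => va; have := cr v Uv va; lia.
  have sp := ends_span Uv; rewrite vi in sp f1.
  have := IH v.-1; have h1 : v.-1 < i by lia.
  move=> /(_ h1); have h2 : a <= v.-1 by lia.
  move=> /(_ h2) h; have := h (fun x Ux xa fx => leq_ltn_trans (ltnW h1) (cr x Ux xa fx)).
  by lia.
have e : ends i = ends i.-1.
  by apply: eq_in_count => v vw; have := nov v vw; move/eqP; lia.
have h1 : i.-1 < i by lia.
have h2 : a <= i.-1 by lia.
have := IH _ h1 h2 (fun x Ux xa fx => leq_ltn_trans (leq_pred i) (cr x Ux xa fx)).
by rewrite e; lia.
Qed.

(** A block which ends strictly inside the span of [u] also starts there,
    after [u]. *)
Lemma ends_inside u i : is_up w u -> u <= i -> i < block_end u ->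
  K * ends i + u <= K * ends u.-1 + i.
Proof.
move=> Uu ui iu; have u0 : 0 < u by case/andP: Uu.
have cr v : is_up w v -> v <= u -> u <= block_end v -> block_end u <= block_end v.
  by move=> Uv; apply: (block_end_nest k0 wD).
have eu : ends u = ends u.-1.
  apply: eq_in_count => v; rewrite mem_upsteps => Uv; have [f1 _ _ _] := block_endP k0 wD Uv.
  by have := cr v Uv; lia.
rewrite -eu; apply: ends_free => // v Uv vu uv.
by apply: leq_trans iu (cr v Uv vu (ltnW uv)).
Qed.

End Ends.

(** Let [v] be the up step of [w'] whose block has the same end as that of
    [u].  By [ends_span] and [ends_inside] each of the two is the last
    position from which the stretch up to this end is balanced, in terms of
    the ends of blocks alone. *)
Lemma ends_up k n w w' u : 0 < k -> dyck k n w -> dyck k n w' ->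
  ends k w =1 ends k w' -> is_up w u -> is_up w' u.
Proof.
move=> k0 wD wD' cE Uu; have sp := ends_span k0 wD Uu.
have [f1 f2 f3 f4] := block_endP k0 wD Uu; have u0 : 0 < u by case/andP: Uu.
have : has (fun v => block_end k w' v == block_end k w u) (upsteps w').
  apply: contraTT isT => /hasPn no.
  have : ends k w' (block_end k w u) = ends k w' (block_end k w u).-1.
    by apply: eq_in_count => v vw; have := no v vw; move/eqP; lia.
  rewrite -!cE => e; have h1 : u <= (block_end k w u).-1 by lia.
  have h2 : (block_end k w u).-1 < block_end k w u by lia.
  by have := ends_inside k0 wD Uu h1 h2; rewrite -e; lia.
case/hasP => v; rewrite mem_upsteps => Uv /eqP vE.
have [g1 g2 g3 g4] := block_endP k0 wD' Uv; have v0 : 0 < v by case/andP: Uv.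
have sp' := ends_span k0 wD' Uv; rewrite vE -!cE in sp' g1.
case: (ltngtP u v) => [uv|vu|->] //.
  have h1 : u <= v.-1 by lia.
  have h2 : v.-1 < block_end k w u by lia.
  by have := ends_inside k0 wD Uu h1 h2; lia.
have h1 : v <= u.-1 by lia.
have h2 : u.-1 < block_end k w' v by lia.
by have := ends_inside k0 wD' Uv h1 h2; rewrite -!cE; lia.
Qed.

Lemma perm_ends_eq k n (p q : kdyck k n) : 0 < k ->
  perm_eq (map (block_end k p) (upsteps p)) (map (block_end k q) (upsteps q)) -> p = q.
Proof.
move=> k0 pe; have cE : ends k p =1 ends k q.
  by move=> i; have := permP pe (fun e => e <= i); rewrite !count_map.
have pD := steps_dyck p; have qD := steps_dyck q.
have U : is_up p =1 is_up q.
  move=> u; apply/idP/idP; first exact: (ends_up k0 pD qD cE).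
  by apply: (ends_up k0 qD pD) => i; rewrite cE.
apply/val_inj/val_inj => /=; apply: ups_inj => [|i _]; first by rewrite !size_tuple.
by elim: i => [|i IH]; rewrite ?ups0 // !upsS IH; have := U i.+1; rewrite /is_up /= => ->.
Qed.

(** * Injectivity and the intertwining relation *)

Section Inverse.

Variables (k n : nat).
Hypothesis k0 : 0 < k.
Hypothesis n0 : 0 < n.

Lemma promotion_invK (P : kdyck k n) : promotion (promotion_inv P) = P.
Proof. exact: f_invF. Qed.

(** [queue_shift], applied at the times [0, ..., j-1] to successive inverse
    promotions. *)
Lemma iter_promotion_inv (P : kdyck k n) j (Y := iter j (@promotion_inv k n) P) : j < n ->
  queue k Y j = map (addn j) (drop j (queue k P 0)) /\
  forall u, u \in drop j (queue k P 0) -> block_end k Y (j + u) = j + block_end k P u.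
Proof.
rewrite {}/Y; elim: j => [|j IH] jn.
  by rewrite drop0 /= (eq_map (g := id)) ?map_id.
have [qE fE] := IH (ltnW jn); rewrite iterS; set Z := iter j _ P in qE fE *.
have [] := queue_shift (promotion_inv Z) k0 n0 (ltnW jn); rewrite promotion_invK qE.
have dr : drop j.+1 (queue k P 0) = behead (drop j (queue k P 0)).
  by rewrite -drop1 drop_drop add1n.
rewrite behead_map -map_comp -dr => e1 e2; split; first by rewrite e1; apply: eq_map.
move=> u ud; rewrite addSn e2; last by apply: map_f.
by rewrite fE //; move: ud; rewrite dr; exact: mem_behead.
Qed.

Lemma last_end_iter (P : kdyck k n) j : j < n ->
  last_end (iter j (@promotion_inv k n) P) j = j + block_end k P (nth 0 (queue k P 0) j).
Proof.
move=> jn; have [qE fE] := iter_promotion_inv P jn.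
have sz := size_queue k0 (steps_dyck P) (leq0n n); rewrite subn0 in sz.
rewrite /last_end qE (drop_nth 0) ?sz //= fE // (drop_nth 0) ?sz //.
exact: mem_head.
Qed.

Variable F : kdyck k n -> kdyck k n.
Hypothesis FE : forall P y, y < n -> row_len (F P) y = k.+1 * n - last_end P y.

Lemma rowmotion_F (P : kdyck k n) : rowmotion (F P) = F (promotion_inv P).
Proof.
apply: (rowmotion_promotion (Y := promotion_inv P)) => // y yn; rewrite FE //.
by rewrite promotion_invK.
Qed.

Lemma F_inj : injective F.
Proof.
move=> P P' PP'; apply: (perm_ends_eq k0).
have it j : F (iter j (@promotion_inv k n) P) = F (iter j (@promotion_inv k n) P').
  by elim: j => // j IH; rewrite !iterS -!rowmotion_F IH.
have e (R : kdyck k n) : perm_eq (map (block_end k R) (upsteps R)) (map (block_end k R) (queue k R 0)).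
  by apply: perm_map; rewrite perm_sym perm_queue0.
rewrite (perm_trans (e P)) // perm_sym (perm_trans (e P')) //.
suff -> : map (block_end k P') (queue k P' 0) = map (block_end k P) (queue k P 0) by [].
have sz (R : kdyck k n) : size (queue k R 0) = n.
  by rewrite (size_queue k0 (steps_dyck R)) ?subn0.
apply: (@eq_from_nth _ 0); first by rewrite !size_map !sz.
move=> j; rewrite size_map sz => jn; rewrite !(nth_map 0) ?sz //.
have rE (R : kdyck k n) : row_len (F (iter j (@promotion_inv k n) R)) j =
    k.+1 * n - (j + block_end k R (nth 0 (queue k R 0) j)) by rewrite FE // last_end_iter.
have le (R : kdyck k n) : j + block_end k R (nth 0 (queue k R 0) j) <= k.+1 * n.
  by rewrite -last_end_iter // last_end_le.
by have := rE P; rewrite it rE; have := le P; have := le P'; lia.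
Qed.

End Inverse.

Theorem proposition7p23 (k n : nat) (hk : 2 <= k) (hn : 1 <= n) :
  exists RSKinv RSK : kdyck k n -> kdyck k n,
    [/\ forall P Q : kdyck k n, RSKinv_graph P Q <-> RSKinv P = Q,
        cancel RSKinv RSK,
        cancel RSK RSKinv
      & forall P : kdyck k n,
          RSK (rowmotion P) = promotion_inv (RSK P)].
Proof.
have k0 : 0 < k by exact: ltnW.
pose F P := sval (RSKinv_exists P k0 hn).
have FE P y : y < n -> row_len (F P) y = k.+1 * n - last_end P y.
  exact: (svalP (RSKinv_exists P k0 hn)).
have Finj := F_inj k0 hn FE.
exists F, (invF Finj); split.
- move=> P Q; split=> [/(RSKinv_graphP P Q k0 hn) QE|<-].
    by apply: kdyck_eq => y yn; rewrite FE // QE.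
  by apply/(RSKinv_graphP P (F P) k0 hn) => y yn; rewrite FE.
- exact: invF_f.
- exact: f_invF.
by move=> P; apply: (F_inj k0 hn FE); rewrite f_invF -(rowmotion_F k0 hn FE) f_invF.
Qed.
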